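(* Let $M$ be a compact $3$-dimensional manifold with boundary, and let $(H\xrightarrow{\partial}G,\rhd)$ be a crossed module in which $H$ and $G$ are finite groups. Let $K$ be a triangulation of $M$ (a finite simplicial complex together with a homeomorphism $|K|\cong M$), let $K_i$ denote the set of $i$-simplices of $K$, and fix a total order on the vertex set $K_0$. Write every simplex with its vertices listed in increasing order, so an edge is $(jk)$ with $j<k$, a triangle is $(jkl)$ with $j<k<l$, and a tetrahedron is $(jklm)$ with $j<k<l<m$. For each assignment of a colour $g_{jk}\in G$ to every edge $(jk)\in K_1$ and a colour $h_{jkl}\in H$ to every triangle $(jkl)\in K_2$, set, for each triangle $(jkl)\in K_2$, $$g_{jkl}:=\partial(h_{jkl})\,g_{kl}\,g_{jk}\,g_{jl}^{-1}\in G,$$ and for each tetrahedron $(jklm)\in K_3$, $$h_{jklm}:=h_{jlm}\,(g_{lm}\rhd h_{jkl})\,h_{klm}^{-1}\,h_{jkm}^{-1}\in H.$$ For a finite group $X$ define $\delta_X:X\to\mathbb{Z}$ by $\delta_X(x)=|X|$ if $x=e_X$ and $\delta_X(x)=0$ otherwise. Define $$Z(M)=|G|^{-|K_0|+|K_1|-|K_2|}\,|H|^{|K_0|-|K_1|+|K_2|-|K_3|}\left(\prod_{(jk)\in K_1}\frac{1}{|G|}\sum_{g_{jk}\in G}\right)\left(\prod_{(jkl)\in K_2}\frac{1}{|H|}\sum_{h_{jkl}\in H}\right)\left(\prod_{(jkl)\in K_2}\delta_G(g_{jkl})\right)\left(\prod_{(jklm)\in K_3}\delta_H(h_{jklm})\right),$$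 i.e. $|G|^{-|K_1|}|H|^{-|K_2|}$ times the prefactor times the sum, over all colourings $(g_{jk})_{(jk)\in K_1}$, $(h_{jkl})_{(jkl)\in K_2}$, of the products of the $\delta$-terms. Then $Z(M)$ does not depend on the choice of the triangulation $K$ of $M$ nor on the choice of the total order on $K_0$; hence it is a topological invariant of $M$.
   Context: A crossed module $(H\xrightarrow{\partial}G,\rhd)$ consists of groups $H,G$, a group homomorphism $\partial:H\to G$, the conjugation action of $G$ on itself ($g_1\rhd g_2=g_1g_2g_1^{-1}$), and a left action $\rhd$ of $G$ on $H$ such that: (i) for each $g\in G$ the map $h\mapsto g\rhd h$ is a group automorphism of $H$; (ii) $\partial(g\rhd h)=g\,\partial(h)\,g^{-1}$ for all $g\in G$, $h\in H$; (iii) (Peiffer identity) $\partial(h)\rhd h'=h\,h'\,h^{-1}$ for all $h,h'\in H$. *)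

(* Defs.v *)
From HB Require Import structures.
From mathcomp Require Import all_boot all_order all_algebra all_fingroup.
From mathcomp Require Import all_classical all_reals all_analysis function_spaces.
Import numFieldNormedType.Exports.
Set Implicit Arguments. Unset Strict Implicit. Unset Printing Implicit Defensive.
Import Order.TTheory GRing.Theory Num.Theory.

Section CrossedModule.
Variables (G H : finGroupType) (d : H -> G) (act : G -> H -> H).
Local Open Scope group_scope.
Definition crossed_module : Prop :=
  (forall x y : H, d (x * y) = d x * d y) /\
  (forall h : H, act 1 h = h) /\
  (forall (g1 g2 : G) (h : H), act (g1 * g2) h = act g1 (act g2 h)) /\
  (forall g : G, (forall x y : H, act g (x * y) = act g x * act g y)
                 /\ bijective (act g)) /\
  (forall (g : G) (h : H), d (act g h) = g * d h * g^-1) /\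
  (forall h h' : H, act (d h) h' = h * h' * h^-1).
End CrossedModule.

Definition simplicial_complex (V : finType) (K : {set {set V}}) : Prop :=
  finset.set0 \notin K /\
  (forall s t : {set V}, s \in K -> t \subset s -> t != finset.set0 -> t \in K) /\
  (forall v : V, [set v] \in K).

Definition simplices (V : finType) (K : {set {set V}}) (i : nat) : {set {set V}} :=
  [set s in K | #|s| == i.+1].

Section Topo.
Local Open Scope classical_set_scope.
Section Realization.
Variables (R : realType) (V : finType) (K : {set {set V}}).
Local Open Scope ring_scope.
(* |K| inside R^V (product topology): barycentric coordinate functions
   whose support is a simplex of K. *)
Definition realization : set {ptws V -> R} :=
  [set x : {ptws V -> R} | (forall v, 0 <= x v) /\ \sum_(v : V) x v = 1 /\
           finset.finset (fun v => x v != 0) \in K].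
End Realization.

Definition triangulation (R : realType) (V : finType) (K : {set {set V}})
    (M : topologicalType) : Prop :=
  exists (f : {ptws V -> R} -> M) (g : M -> {ptws V -> R}),
    {within @realization R V K, continuous f} /\ continuous g /\
    (forall x, @realization R V K x -> g (f x) = x) /\
    (forall p : M, @realization R V K (g p) /\ f (g p) = p).

Definition half_space (R : realType) : set 'rV[R]_3 :=
  [set x | (0 <= x ord0 (@ord_max 2))%R].

Definition manifold3_with_boundary (R : realType) (M : topologicalType) : Prop :=
  forall p : M, exists U : set M, open U /\ U p /\
    exists (phi : M -> 'rV[R]_3) (W : set 'rV[R]_3) (psi : 'rV[R]_3 -> M),
      open W /\ phi @` U = W `&` @half_space R /\
      {within U, continuous phi} /\
      (forall x, U x -> psi (phi x) = x) /\
      {within phi @` U, continuous psi}.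

End Topo.

Section StateSum.
Variables (G H : finGroupType) (d : H -> G) (act : G -> H -> H).
Variables (V : finType) (K : {set {set V}}) (rank : V -> nat).

Definition ordered_vertices (s : {set V}) : seq V :=
  sort (fun a b => rank a <= rank b) (enum s).

Local Open Scope group_scope.

Definition face_holonomy (g : {ffun {set V} -> G}) (h : {ffun {set V} -> H})
    (t : {set V}) : G :=
  match ordered_vertices t with
  | [:: j; k; l] => d (h t) * g [set k; l] * g [set j; k] * (g [set j; l])^-1
  | _ => 1
  end.

Definition tet_holonomy (g : {ffun {set V} -> G}) (h : {ffun {set V} -> H})
    (t : {set V}) : H :=
  match ordered_vertices t with
  | [:: j; k; l; m] => h [set j; l; m] * act (g [set l; m]) (h [set j; k; l])
                       * (h [set k; l; m])^-1 * (h [set j; k; m])^-1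
  | _ => 1
  end.

Local Close Scope group_scope.
Local Open Scope ring_scope.

Definition deltaQ (X : finGroupType) (x : X) : rat :=
  if x == 1%g then (#|X|%:R) else 0.

Definition nK (i : nat) : int := (#|simplices K i|)%:Z.

(* colourings: g on edges, h on triangles (trivial elsewhere, i.e. the sum
   ranges over functions K_1 -> G and K_2 -> H) *)
Definition edge_colouring (g : {ffun {set V} -> G}) : bool :=
  [forall s, (s \notin simplices K 1) ==> (g s == 1%g)].
Definition face_colouring (h : {ffun {set V} -> H}) : bool :=
  [forall s, (s \notin simplices K 2) ==> (h s == 1%g)].

Definition Zinv : rat :=
  (#|G|%:R : rat) ^ (- nK 0 + nK 1 - nK 2)
  * (#|H|%:R : rat) ^ (nK 0 - nK 1 + nK 2 - nK 3)
  * (#|G|%:R : rat) ^ (- nK 1)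
  * (#|H|%:R : rat) ^ (- nK 2)
  * \sum_(g : {ffun {set V} -> G} | edge_colouring g)
      \sum_(h : {ffun {set V} -> H} | face_colouring h)
        ((\prod_(t in simplices K 2) deltaQ (face_holonomy g h t))
         * (\prod_(t in simplices K 3) deltaQ (tet_holonomy g h t))).
End StateSum.

(* Main.v *)
Require Import Defs.
From HB Require Import structures.
From mathcomp Require Import all_boot all_order all_algebra all_fingroup.
From mathcomp Require Import all_classical all_reals all_analysis function_spaces.
From mathcomp Require Import ring lra.
Import numFieldNormedType.Exports.
Set Implicit Arguments. Unset Strict Implicit. Unset Printing Implicit Defensive.
Import Order.TTheory GRing.Theory Num.Theory.

(** The state sum equals [|G|^-n0 * |H|^(n0 - n1)] times the number of flat ordered colourings,
    which is the homotopy cardinality of the space of maps from [|K|] to the classifying space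
    of the crossed module; it therefore only depends on the homotopy type of [|K|].

    Concretely, flat colourings of all tuples of vertices spanning a simplex (so that any
    simplicial map acts by pullback) form a 2-groupoid: gauge transformations relate colourings
    and 2-gauge transformations [gam] relate gauge transformations. Its homotopy cardinality
    is the sum over gauge classes of [|pi_2| / |pi_1|], and restricting a colouring to increasing
    tuples identifies this number with the state sum for any vertex order.

    If all simplices containing [T] can be enlarged by a vertex [m] outside [T], deleting them
    changes neither gauge classes nor [pi_1], [pi_2], because on the star of [m] every flat
    colouring is a gauge transform of the trivial one. Such deletions relate a complex to its
    barycentric subdivision and show that contiguous maps act alike. Given homeomorphic
    complexes [K1], [K2], simplicial approximations [psi : Sd^m K2 -> Sd^n K1] and
    [phi : Sd^n K1 -> K2] compose to a map contiguous to the subdivision map, so pullback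
    along [phi] is injective on classes, [pi_1] and [pi_2]. By symmetry and finiteness the two
    homotopy cardinalities agree. *)

(** * Gauge transformations of flat colourings *)

(** The proof avoids moves between triangulations and never compares composites in both orders. Only
    injectivity is tracked: pullback along [phi \o psi] factors through pullback along [phi], so
    injectivity passes to [phi] alone, and opposite injections between finite sets become
    bijections. Since the order of pi_1 sits in a denominator, the orders of pi_1 and pi_2 are
    bounded separately, and equality of their sums forces equality class by class. Tuples with
    repetitions and in any order carry colours because the vertex maps that occur (choosing a vertex
    of each face, simplicial approximations) collapse simplices and respect no order. The price is
    extra, unnormalised data on degenerate and decreasing tuples, which flatness either determines
    or leaves entirely free; the free part is counted and cancels against the gauge
    transformations. *)

Section Gauge.
Local Open Scope group_scope.
Variables (G H : finGroupType) (d : H -> G) (act : G -> H -> H).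
Hypothesis cm : crossed_module d act.

Lemma cm_dM (x y : H) : d (x * y) = d x * d y.
Proof. by case: cm. Qed.
Lemma cm_act1 (h : H) : act 1 h = h.
Proof. by case: cm => _ []. Qed.
Lemma cm_actA (g1 g2 : G) (h : H) : act (g1 * g2) h = act g1 (act g2 h).
Proof. by case: cm => _ [_ []]. Qed.
Lemma cm_actM (g : G) (x y : H) : act g (x * y) = act g x * act g y.
Proof. by case: cm => _ [_ [_ [/(_ g)[]]]]. Qed.
Lemma cm_dact (g : G) (h : H) : d (act g h) = g * d h * g^-1.
Proof. by case: cm => _ [_ [_ [_ []]]]. Qed.
Lemma cm_peif (h h' : H) : act (d h) h' = h * h' * h^-1.
Proof. by case: cm => _ [_ [_ [_ []]]]. Qed.

Lemma cm_d1 : d 1 = 1.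
Proof. by apply: (mulgI (d 1)); rewrite -cm_dM !mulg1. Qed.
Lemma cm_dV h : d h^-1 = (d h)^-1.
Proof. by apply: (mulgI (d h)); rewrite -cm_dM !mulgV cm_d1. Qed.
Lemma cm_act_1 g : act g 1 = 1.
Proof. by apply: (mulgI (act g 1)); rewrite -cm_actM !mulg1. Qed.
Lemma cm_actV g h : act g h^-1 = (act g h)^-1.
Proof. by apply: (mulgI (act g h)); rewrite -cm_actM !mulgV cm_act_1. Qed.
Lemma cm_actK g h : act g (act g^-1 h) = h.
Proof. by rewrite -cm_actA mulgV cm_act1. Qed.
Lemma cm_actKV g h : act g^-1 (act g h) = h.
Proof. by rewrite -cm_actA mulVg cm_act1. Qed.
Lemma cm_peifV h h' : act (d h)^-1 h' = h^-1 * h' * h.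
Proof. by rewrite -cm_dV cm_peif invgK. Qed.

Lemma cm_central h k : d k = 1 -> h * k * h^-1 = k.
Proof.
move=> dk; have : act (d k) h = h by rewrite dk cm_act1.
by rewrite cm_peif => e; apply: (mulIg h); rewrite mulgKV -{1}e mulgKV.
Qed.

(** Pushes [d] and [act] down to the generators; the Peiffer identity turns the action of a boundary
    into conjugation, so that many identities become equalities of reduced words. *)
Ltac cms := rewrite !(cm_d1, cm_dV, cm_dM, cm_dact, cm_act1, cm_act_1, cm_actM, cm_actV, cm_actA,
  cm_actK, cm_actKV, cm_peif, cm_peifV, invMg, invgK, invg1, mulgA, mulg1, mul1g,
  mulgV, mulVg, mulgK, mulgKV).

Definition col (V : Type) := ((V -> V -> G) * (V -> V -> V -> H))%type.
Definition gau (V : Type) := ((V -> G) * (V -> V -> H))%type.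

Section OneType.
Variable V : eqType.
Implicit Types (P Q : pred (seq V)) (x y z : col V) (s t : gau V) (r : V -> H).

(** Membership of [t] in [s] rather than sublists: a monotone [P] sees only the set of vertices of a
    tuple, hence is closed under faces, permutations and repetitions. *)
Definition mono P := forall s t : seq V, {subset t <= s} -> P s -> P t.

(** Colourings are total functions whose values off [P] are meaningless, so every identity is stated
    up to agreement on [P]. *)
Definition eqx P x y :=
  (forall u v, P [:: u; v] -> x.1 u v = y.1 u v) /\
  (forall u v w, P [:: u; v; w] -> x.2 u v w = y.2 u v w).
Definition eqs P s t :=
  (forall u, P [:: u] -> s.1 u = t.1 u) /\
  (forall u v, P [:: u; v] -> s.2 u v = t.2 u v).
Definition eqr P r r' := forall u, P [:: u] -> r u = r' u.

(** Degenerate tuples are included without normalisation: on [[:: v; v; v]] flatness only gives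
    [x.1 v v = (d (x.2 v v v))^-1]. *)
Definition flat P x :=
  (forall j k l, P [:: j; k; l] -> d (x.2 j k l) * x.1 k l * x.1 j k = x.1 j l) /\
  (forall j k l m, P [:: j; k; l; m] ->
     x.2 j l m * act (x.1 l m) (x.2 j k l) = x.2 j k m * x.2 k l m).

(* The new triangle colour [h'] is the one forced by [d h' * g'_kl * g'_jk = g'_jl]. *)
Definition gact s x : col V :=
  (fun u v => d (s.2 u v) * s.1 v * x.1 u v * (s.1 u)^-1,
   fun j k l => s.2 j l * act (s.1 l) (x.2 j k l) * (s.2 k l)^-1 *
     (act (d (s.2 k l) * s.1 l * x.1 k l * (s.1 k)^-1) (s.2 j k))^-1).
Definition gmul s t : gau V :=
  (fun u => s.1 u * t.1 u, fun u v => s.2 u v * act (s.1 v) (t.2 u v)).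
Definition ginv s : gau V :=
  (fun u => (s.1 u)^-1, fun u v => act (s.1 v)^-1 (s.2 u v)^-1).
Definition gone : gau V := (fun _ => 1, fun _ _ => 1).
(* The gauge transformation induced by a 2-gauge transformation [r]; it fixes [x]. *)
Definition gam x r : gau V :=
  (fun u => d (r u), fun u v => act (x.1 u v) (r u) * (r v)^-1).
Definition triv : col V := (fun _ _ => 1, fun _ _ _ => 1).
(** This is pi_2 at [x]: sections of the kernel of [d] that are parallel along [x]. By [gam_ker]
    they are the [r] whose [gam x r] is trivial. *)
Definition ker P x r :=
  (forall u, P [:: u] -> d (r u) = 1) /\
  (forall u v, P [:: u; v] -> act (x.1 u v) (r u) = r v).

Lemma mono_sub P (s t : seq V) : mono P -> all (mem s) t -> P s -> P t.
Proof. by move=> mP /allP st; apply: mP. Qed.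

Ltac sub mP := (apply: (mono_sub mP _ (s := _)); last by eassumption); rewrite /= !inE !eqxx ?orbT.

Lemma eqx_refl P x : eqx P x x. Proof. by split. Qed.
Lemma eqx_sym P x y : eqx P x y -> eqx P y x.
Proof. by case=> a b; split=> *; rewrite ?a ?b. Qed.
Lemma eqx_trans P x y z : eqx P x y -> eqx P y z -> eqx P x z.
Proof. by case=> a b [c e]; split=> *; rewrite ?a ?b ?c ?e. Qed.
Lemma eqs_refl P s : eqs P s s. Proof. by split. Qed.
Lemma eqs_sym P s t : eqs P s t -> eqs P t s.
Proof. by case=> a b; split=> *; rewrite ?a ?b. Qed.
Lemma eqs_trans P s t s' : eqs P s t -> eqs P t s' -> eqs P s s'.
Proof. by case=> a b [c e]; split=> *; rewrite ?a ?b ?c ?e. Qed.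
Lemma eqx_sub P Q x y : subpred Q P -> eqx P x y -> eqx Q x y.
Proof. by move=> sQP [a b]; split=> *; rewrite ?a ?b //; apply: sQP. Qed.
Lemma eqs_sub P Q s t : subpred Q P -> eqs P s t -> eqs Q s t.
Proof. by move=> sQP [a b]; split=> *; rewrite ?a ?b //; apply: sQP. Qed.
Lemma flat_sub P Q x : subpred Q P -> flat P x -> flat Q x.
Proof. by move=> sQP [a b]; split=> *; rewrite ?a ?b //; apply: sQP. Qed.

Lemma flat_eqx P x y : mono P -> eqx P x y -> flat P x -> flat P y.
Proof.
move=> mP [e1 e2] [f1 f2]; split=> [j k l p|j k l m p].
  by rewrite -!e1 -?e2 ?f1 //; sub mP.
by rewrite -!e1 -?e2 ?f2 //; sub mP.
Qed.

Lemma gact_eq P s t x y : mono P -> eqs P s t -> eqx P x y ->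
  eqx P (gact s x) (gact t y).
Proof.
move=> mP [a b] [c e]; split=> [u v p|u v w p] /=.
  by rewrite b // c // !a //; sub mP.
by rewrite !b ?e ?c ?a //; sub mP.
Qed.

Lemma gmul_eq P s t s' t' : mono P -> eqs P s t -> eqs P s' t' ->
  eqs P (gmul s s') (gmul t t').
Proof.
move=> mP [a b] [c e]; split=> [u p|u v p] /=; first by rewrite a ?c.
by rewrite b // e // a //; sub mP.
Qed.


Lemma gact1 P x : eqx P (gact gone x) x.
Proof. by split=> * /=; cms. Qed.

Lemma gactM P s t x : eqx P (gact (gmul s t) x) (gact s (gact t x)).
Proof. by split=> * /=; cms. Qed.

Lemma gmulA P s t s' : eqs P (gmul s (gmul t s')) (gmul (gmul s t) s').
Proof. by split=> * /=; cms. Qed.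
Lemma gmul1 P s : eqs P (gmul gone s) s.
Proof. by split=> * /=; cms. Qed.
Lemma gmulg1 P s : eqs P (gmul s gone) s.
Proof. by split=> * /=; cms. Qed.
Lemma gmulV P s : eqs P (gmul s (ginv s)) gone.
Proof. by split=> * /=; cms. Qed.
Lemma gmulVg P s : eqs P (gmul (ginv s) s) gone.
Proof. by split=> * /=; cms. Qed.

Lemma flat_gact P s x : mono P -> flat P x -> flat P (gact s x).
Proof.
move=> mP [f1 f2]; split=> [j k l p|j k l m p] /=.
  by rewrite -(f1 _ _ _ p); cms.
have p' : P [:: k; l; m] by sub mP.
have p2 := f2 _ _ _ _ p.
(* Eliminating [x.1 k m] and [x.2 j l m] by flatness leaves a word identity that [cms] decides. *)
have -> : x.1 k m = d (x.2 k l m) * x.1 l m * x.1 k l by rewrite f1.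
have e : x.2 j l m = x.2 j k m * x.2 k l m * (act (x.1 l m) (x.2 j k l))^-1.
  by rewrite -p2 mulgK.
by rewrite e; cms.
Qed.

Lemma flat_triv P : flat P triv.
Proof. by split=> * /=; cms. Qed.

Lemma gam_stab P x r : mono P -> flat P x -> eqx P (gact (gam x r) x) x.
Proof.
move=> mP [f1 f2]; split=> [u v p|j k l p] /=; first by cms.
by rewrite -(f1 _ _ _ p); cms.
Qed.

Lemma gam_eq P x y r r' : mono P -> eqx P x y -> eqr P r r' ->
  eqs P (gam x r) (gam y r').
Proof.
move=> mP [a b] e; split=> [u p|u v p] /=; first by rewrite e.
by rewrite a // !e //; sub mP.
Qed.

Lemma gamM P x r r' :
  eqs P (gmul (gam x r) (gam x r')) (gam x (fun u => r u * r' u)).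
Proof. by split=> * /=; cms. Qed.
Lemma gamV P x r : eqs P (ginv (gam x r)) (gam x (fun u => (r u)^-1)).
Proof. by split=> * /=; cms. Qed.
Lemma gam1 P x : eqs P (gam x (fun => 1)) gone.
Proof. by split=> * /=; cms. Qed.
Lemma gamJ P x s r :
  eqs P (gmul s (gam x r)) (gmul (gam (gact s x) (fun u => act (s.1 u) (r u))) s).
Proof. by split=> * /=; cms. Qed.

Lemma gam_ker P x r : eqs P (gam x r) gone <-> ker P x r.
Proof.
split=> -[a b]; split=> //= u v p; last by rewrite b // mulgV.
by apply: (mulIg (r v)^-1); rewrite mulgV; apply: b.
Qed.

Definition gtrel P x y := exists s, eqx P (gact s x) y.

Lemma gtrel_sym P x y : mono P -> gtrel P x y -> gtrel P y x.
Proof.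
move=> mP [s sx]; exists (ginv s); apply: eqx_trans (gact1 P x).
apply: eqx_trans (gact_eq mP (gmulVg P s) (eqx_refl P x)).
apply: eqx_trans (eqx_sym (gactM P _ _ _)).
exact: (gact_eq mP (eqs_refl _ _) (eqx_sym sx)).
Qed.

Lemma gtrel_trans P x y z : mono P -> gtrel P x y -> gtrel P y z -> gtrel P x z.
Proof.
move=> mP [s sx] [t ty]; exists (gmul t s); apply: eqx_trans ty.
apply: eqx_trans (gactM P _ _ _) _.
exact: (gact_eq mP (eqs_refl _ _)).
Qed.

Lemma gtrel_eqx P x y : eqx P x y -> gtrel P x y.
Proof. by move=> e; exists gone; apply: eqx_trans (gact1 P x) e. Qed.

(* On the star of [m] a flat colouring is the gauge transform of the trivial one
   by [coneg m x]. *)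
Definition coneg (m : V) x : gau V := (fun v => x.1 m v, fun v w => (x.2 m v w)^-1).

Definition simplex_on (S : seq V) : pred (seq V) := fun t : seq V => all (mem S) t.

Lemma mono_simplex_on S : mono (simplex_on S).
Proof. by move=> a b ba /allP sa; apply/allP => i /ba /sa. Qed.

(** Flatness on [[:: m; u; v]] and [[:: m; u; v; w]] solves for the colours of [(u, v)] and
    [(u, v, w)] in terms of tuples starting at [m], and the solution is the transformed trivial
    colouring. The vertex [m] may occur among [u], [v], [w]. *)
Lemma coneg_eqx m x (S : seq V) : flat (simplex_on (m :: S)) x ->
  eqx (simplex_on (m :: S)) (gact (coneg m x) triv) x.
Proof.
move=> [f1 f2]; split=> [u v p|u v w p] /=.
  have /f1 <- : simplex_on (m :: S) [:: m; u; v] by rewrite /simplex_on /= inE eqxx.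
  by cms.
have q : simplex_on (m :: S) [:: m; u; v; w] by rewrite /simplex_on /= inE eqxx.
have /f1 e : simplex_on (m :: S) [:: m; v; w].
  by apply: mono_simplex_on q => i; rewrite !inE => /or3P[] ->; rewrite ?orbT.
by apply: (mulgI (x.2 m u w)); rewrite -(f2 _ _ _ _ q) -e; cms.
Qed.


Lemma eqx_loc P x y : (forall S : seq V, P S -> eqx (simplex_on S) x y) -> eqx P x y.
Proof.
move=> loc; split=> [u v p|u v w p]; [apply: (loc _ p).1|apply: (loc _ p).2];
  by rewrite /simplex_on /= !inE !eqxx ?orbT.
Qed.
Lemma eqs_loc P s t : (forall S : seq V, P S -> eqs (simplex_on S) s t) -> eqs P s t.
Proof.
move=> loc; split=> [u p|u v p]; [apply: (loc _ p).1|apply: (loc _ p).2];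
  by rewrite /simplex_on /= !inE !eqxx ?orbT.
Qed.
Lemma flat_loc P x : (forall S : seq V, P S -> flat (simplex_on S) x) -> flat P x.
Proof.
move=> loc; split=> [j k l p|j k l m p]; [apply: (loc _ p).1|apply: (loc _ p).2];
  by rewrite /simplex_on /= !inE !eqxx ?orbT.
Qed.
Lemma sub_simplex_on P S : mono P -> P S -> subpred (simplex_on S) P.
Proof. by move=> mP pS t /allP tS; apply: mP pS. Qed.

Lemma cone_eqx P m (S : seq V) x : mono P -> flat P x -> P (m :: S) ->
  eqx (simplex_on S) (gact (coneg m x) triv) x.
Proof.
move=> mP fx jS; have := coneg_eqx (flat_sub (sub_simplex_on mP jS) fx).
apply: eqx_sub => t /allP tS; apply/allP => i /tS; rewrite !inE => ->.
by rewrite orbT.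
Qed.

(** * Deleting the simplices that contain a dominated face *)

Section Dominated.
Variables (J : pred (seq V)) (T : seq V) (m : V).
Hypotheses (mJ : mono J) (T0 : T != [::]) (mT : m \notin T).
Hypothesis dom : forall S, J S -> {subset T <= S} -> J (m :: S).

Definition remove_star : pred (seq V) := fun S => J S && ~~ all (mem S) T.
Local Notation J0 := remove_star.

Lemma mono_remove_star : mono J0.
Proof.
move=> S S' sub /andP[jS nS]; rewrite /J0 (mJ sub jS).
by apply: contra nS => /allP a; apply/allP => i /a /sub.
Qed.
Let m0 := mono_remove_star.

(** As [m] is outside [T], coning with [m] cannot complete [T]. *)
Lemma remove_star_cons S : J (m :: S) -> J0 S -> J0 (m :: S).
Proof.
move=> jm /andP[_ nS]; rewrite /J0 jm /=; apply: contra nS => /allP a.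
apply/allP => i iT; have := a i iT; rewrite !inE => /orP[/eqP e|//].
by move: mT; rewrite -e iT.
Qed.

Lemma remove_starP S : J S -> ~~ J0 S -> J (m :: S).
Proof.
by move=> jS; rewrite /J0 jS /= negbK => /allP a; apply: dom => // i /a.
Qed.

Lemma remove_star_apex S : J (m :: S) -> J0 [:: m].
Proof.
move=> jm; rewrite /J0; apply/andP; split.
  by apply: mJ jm => i; rewrite !inE => ->.
apply/negP => /allP a; case: (T) T0 mT a => // b T' _; rewrite inE negb_or.
by case/andP=> nb _ /(_ b); rewrite !inE eqxx eq_sym (negPf nb) => /(_ isT).
Qed.

Lemma cone_face (S S' : seq V) : J S -> ~~ J0 S -> simplex_on S S' -> J (m :: S').
Proof.
move=> jS nS /allP S'S; apply: mJ (remove_starP jS nS) => i.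
by rewrite !inE => /orP[->//|/S'S]; rewrite inE => ->; rewrite orbT.
Qed.

(** On deleted simplices the extension is the transform of the trivial colouring by [t], the cone of
    [x] from [m] padded with 1 where [x] is not prescribed. Any padding gives a flat colouring. *)
Lemma remove_star_extend x : flat J0 x -> exists2 y, flat J y & eqx J0 y x.
Proof.
move=> fx.
pose t : gau V := (fun v => if J0 [:: m; v] then x.1 m v else 1,
  fun v w => if J0 [:: m; v; w] then (x.2 m v w)^-1 else 1).
pose c := gact t triv.
pose y : col V := (fun u v => if J0 [:: u; v] then x.1 u v else c.1 u v,
  fun u v w => if J0 [:: u; v; w] then x.2 u v w else c.2 u v w).
have yx : eqx J0 y x by split=> *; rewrite /y /= ifT.
exists y => //; apply: flat_loc => S jS.
have [oS|nS] := boolP (J0 S).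
  apply: (flat_sub (sub_simplex_on m0 oS)).
  exact: (flat_eqx m0 (eqx_sym yx) fx).
apply: (flat_eqx (x := c)) (flat_gact _ (@mono_simplex_on S) (flat_triv _)).
  exact: mono_simplex_on.
(* A surviving face of a deleted simplex can be coned with [m] inside [J0], so there [t] is the true
   cone and the transform returns [x]. *)
have key S' : simplex_on S S' -> J0 S' -> eqx (simplex_on S') c x.
  move=> S'S o; have jm := cone_face jS nS S'S.
  have o' := remove_star_cons jm o.
  apply: eqx_trans (cone_eqx m0 fx o'); apply: gact_eq (eqx_refl _ _).
    exact: mono_simplex_on.
  split=> [u|u v] /allP i; rewrite /= ifT //; apply: m0 o' => w; rewrite !inE.
    by move=> /orP[->//|wu]; apply/orP; right; apply: i; rewrite inE.
  by move=> /or3P[->//|wu|wu]; apply/orP; right; apply: i; rewrite !inE wu ?orbT.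
move: @c @y yx key => c y _ key; split=> [u v i|u v w i].
  change (c.1 u v = if J0 [:: u; v] then x.1 u v else c.1 u v).
  by case: ifP => // o; apply: (key _ i o).1; apply/allP.
change (c.2 u v w = if J0 [:: u; v; w] then x.2 u v w else c.2 u v w).
by case: ifP => // o; apply: (key _ i o).2; apply/allP.
Qed.

(** Near a deleted simplex both colourings are transforms of the trivial one, so the quotient [c] of
    their cones carries [x] to [y]. On faces in [J0] the two cones agree, hence replacing [c] by 1
    there changes nothing. *)
Lemma remove_star_fibre x y : flat J x -> flat J y -> eqx J0 x y ->
  exists2 s, eqs J0 s gone & eqx J (gact s x) y.
Proof.
move=> fx fy xy.
pose c := gmul (coneg m y) (ginv (coneg m x)).
pose s : gau V := (fun v => if J0 [:: v] then 1 else c.1 v,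
  fun v w => if J0 [:: v; w] then 1 else c.2 v w).
have s1 : eqs J0 s gone by split=> *; rewrite /s /= ifT.
exists s => //; apply: eqx_loc => S jS.
have [oS|nS] := boolP (J0 S).
  apply: (eqx_sub (sub_simplex_on m0 oS)); apply: eqx_trans xy.
  by apply: eqx_trans (gact1 _ x); apply: gact_eq => //; apply: eqx_refl.
have mS := @mono_simplex_on S.
have sc : eqs (simplex_on S) s c.
  split=> [u|u v] i /=; case: ifP => // o.
    have [e _] := xy; have := remove_star_cons (cone_face jS nS i) o.
    by move/e => ->; rewrite mulgV.
  have [e e'] := xy; have o' := remove_star_cons (cone_face jS nS i) o.
  rewrite e' // e; first by cms.
  by apply: m0 o' => a; rewrite !inE => /orP[] ->; rewrite ?orbT.
have jm := remove_starP jS nS.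
apply: eqx_trans (cone_eqx mJ fy jm).
apply: eqx_trans (gact_eq mS sc (eqx_sym (cone_eqx mJ fx jm))) _.
apply: eqx_trans (gactM _ _ _ _) _.
apply: gact_eq => //.
apply: eqx_trans (eqx_sym (gactM _ _ _ _)) _.
by apply: eqx_trans (gact1 _ _); apply: gact_eq => //; apply: gmulVg.
Qed.

(** The 2-gauge transformation is read off along the edges from [m]: as [s] is trivial at [m],
    invariance of the colour of [(m, v)] gives [s.1 v = d (s.2 m v)^-1], and invariance on
    [(m, v, w)] then determines [s.2 v w]. *)
Lemma remove_star_stab x s : flat J x -> eqs J0 s gone -> eqx J (gact s x) x ->
  exists2 r, eqr J0 r (fun => 1) & eqs J s (gam x r).
Proof.
move=> fx [s1 s2] [sx1 sx2].
pose r v := if J0 [:: v] then 1 else (s.2 m v)^-1.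
exists r; first by move=> v o; rewrite /r o.
apply: eqs_loc => S jS.
have [oS|nS] := boolP (J0 S).
  apply: (eqs_sub (sub_simplex_on m0 oS)).
  apply: eqs_trans (eqs_trans (eqs_sym (gam1 _ x)) _) => //.
  by apply: gam_eq => // v o; rewrite /r o.
have jm := remove_starP jS nS.
have oap := remove_star_apex jm.
have sm : s.1 m = 1 by rewrite s1.
have re v : simplex_on S [:: v] -> r v = (s.2 m v)^-1.
  move=> i; rewrite /r; case: ifP => // o.
  by rewrite s2 ?invg1 //; apply: remove_star_cons o; apply: cone_face i.
have pv v : simplex_on S [:: v] -> s.1 v = d (r v).
  move=> i; have j := cone_face jS nS i.
  have := sx1 _ _ j; rewrite /= sm invg1 mulg1 re // => e.
  apply: (mulgI (d (s.2 m v))); apply: (mulIg (x.1 m v)).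
  by rewrite e cm_dV mulgV mul1g.
split=> [v i|v w i]; first exact: pv.
have iv : simplex_on S [:: v].
  by apply: mono_simplex_on i => a; rewrite !inE => ->.
have iw : simplex_on S [:: w].
  by apply: mono_simplex_on i => a; rewrite !inE => ->; rewrite orbT.
have j := cone_face jS nS i.
have jvw : J [:: v; w].
  by apply: mJ j => a; rewrite !inE => /orP[] ->; rewrite ?orbT.
have := sx2 _ _ _ j; have /= e := sx1 _ _ jvw.
rewrite /= e pv // !re // => e'.
apply: invg_inj; apply: (mulgI (x.2 m v w * s.2 m w)).
apply: (mulIg (act (x.1 v w) (s.2 m v))^-1).
by move: e'; cms => ->.
Qed.

Lemma remove_star_ker x r : ker J x r -> eqr J0 r (fun => 1) -> eqr J r (fun => 1).
Proof.
move=> [k1 k2] r1 v jv; have [/r1//|nv] := boolP (J0 [:: v]).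
have j : J [:: m; v] by apply: cone_face jv nv _; apply/allP.
have oap := remove_star_apex j.
by rewrite -(k2 _ _ j) r1 // cm_act_1.
Qed.

(** The missing values are transported from [m]. Transport along [(m, v, w)] and along [(m, w)]
    differ by conjugation with a colour in [H], which is harmless because elements of the kernel of
    [d] are central. *)
Lemma remove_star_ker_extend x r : flat J x -> ker J0 x r ->
  exists2 r', ker J x r' & eqr J0 r' r.
Proof.
move=> fx [k1 k2].
pose r' v := if J0 [:: v] then r v else act (x.1 m v) (r m).
have r'r : eqr J0 r' r by move=> v o; rewrite /r' o.
exists r' => //.
have oap v : J [:: v] -> ~~ J0 [:: v] -> J0 [:: m].
  move=> jv nv; have j : J [:: m; v] by apply: cone_face jv nv _; apply/allP.
  exact: remove_star_apex j.
split=> [v jv|v w jvw].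
  rewrite /r'; case: ifPn => [/k1//|nv]; rewrite cm_dact k1 ?mulg1 ?mulgV //.
  exact: oap nv.
have [ o|n] := boolP (J0 [:: v; w]).
  have ov : J0 [:: v] by apply: m0 o => a; rewrite !inE => ->.
  have ow : J0 [:: w] by apply: m0 o => a; rewrite !inE => ->; rewrite orbT.
  by rewrite !r'r // k2.
have re u : u \in [:: v; w] -> r' u = act (x.1 m u) (r m).
  move=> i; rewrite /r'; case: ifP => // ou; rewrite k2 //.
  apply: remove_star_cons ou; apply: cone_face jvw n _.
  by rewrite /simplex_on /= i.
rewrite !re ?inE ?eqxx ?orbT // -cm_actA.
have jm := remove_starP jvw n; have [f1 _] := fx.
have o1 := remove_star_apex jm.
by rewrite -(f1 _ _ _ jm) !cm_actA cm_peif cm_central // !cm_dact k1 // !(mulg1, mulgV).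
Qed.

End Dominated.
End OneType.

(** * Pullback along simplicial maps *)

Definition pbx (V W : Type) (f : V -> W) (x : col W) : col V :=
  (fun u v => x.1 (f u) (f v), fun u v w => x.2 (f u) (f v) (f w)).
Definition pbs (V W : Type) (f : V -> W) (s : gau W) : gau V :=
  (fun u => s.1 (f u), fun u v => s.2 (f u) (f v)).

Definition simplicial (V W : eqType) (f : V -> W) (L : pred (seq V)) (K : pred (seq W)) :=
  forall S, L S -> K (map f S).

(** The three clauses say that pullback along [f] is injective on gauge classes, on pi_1 and on
    pi_2. *)
Definition faithful (V W : eqType) (f : V -> W) (L : pred (seq V)) (K : pred (seq W)) :=
  [/\ forall x y, flat K x -> flat K y ->
        gtrel L (pbx f x) (pbx f y) -> gtrel K x y,
      forall x s r, flat K x -> eqx K (gact s x) x ->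
        eqs L (pbs f s) (gam (pbx f x) r) -> exists r', eqs K s (gam x r')
    & forall x r, flat K x -> ker K x r -> eqr L (r \o f) (fun => 1) ->
        eqr K r (fun => 1)].

(** The surjective counterpart of [faithful]: one extension [y] of [x] serves to lift all of pi_1
    and pi_2 at [x]. *)
Definition extending (V W : eqType) (f : V -> W) (L : pred (seq V)) (K : pred (seq W)) :=
  forall x, flat L x -> exists y,
    [/\ flat K y, eqx L (pbx f y) x,
        forall s, eqx L (gact s x) x ->
          exists2 s', eqx K (gact s' y) y & eqs L (pbs f s') s
      & forall r, ker L x r -> exists2 r', ker K y r' & eqr L (r' \o f) r].

Ltac pb sf := match goal with h : is_true (_ _) |- _ => exact: (sf _ h) end.

Section Maps.
Variables (V W U : eqType) (f : V -> W) (g : W -> U).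
Variables (L : pred (seq V)) (K : pred (seq W)) (N : pred (seq U)).

Lemma flat_pbx x : simplicial f L K -> flat K x -> flat L (pbx f x).
Proof. by move=> sf [f1 f2]; split=> *; [apply: f1|apply: f2]; pb sf. Qed.
Lemma eqx_pbx x y : simplicial f L K -> eqx K x y -> eqx L (pbx f x) (pbx f y).
Proof. by move=> sf [f1 f2]; split=> *; [apply: f1|apply: f2]; pb sf. Qed.
Lemma eqs_pbs x y : simplicial f L K -> eqs K x y -> eqs L (pbs f x) (pbs f y).
Proof. by move=> sf [f1 f2]; split=> *; [apply: f1|apply: f2]; pb sf. Qed.
Lemma ker_pb x r : simplicial f L K -> ker K x r -> ker L (pbx f x) (r \o f).
Proof. by move=> sf [f1 f2]; split=> *; [apply: f1|apply: f2]; pb sf. Qed.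

(** Pullback along [g \o f] factors through pullback along [g], so injectivity of the former forces
    that of the latter. This is what makes one-sided homotopy inverses sufficient. *)
Lemma faithful_left : simplicial f L K -> faithful (g \o f) L N -> faithful g K N.
Proof.
move=> sf [f0 f1 f2]; split=> [x y fx fy [s e]|x s r fx sx e|x r fx k e].
- by apply: f0 => //; exists (pbs f s); apply: (eqx_pbx sf e).
- by apply: (f1 x s (r \o f)) => //; apply: (eqs_pbs sf e).
by apply: (f2 x) => // u Lu; apply: e; apply: (sf _ Lu).
Qed.
End Maps.

Section Composition.
Variables (V W U : eqType) (f : V -> W) (g : W -> U).
Variables (L : pred (seq V)) (K : pred (seq W)) (N : pred (seq U)).


Lemma faithful_comp : simplicial g K N ->
  faithful f L K -> faithful g K N -> faithful (g \o f) L N.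
Proof.
move=> sg [f0 f1 f2] [g0 g1 g2]; split=> [x y fx fy e|x s r fx sx e|x r fx k e].
- by apply: g0 => //; apply: f0 => //; apply: (flat_pbx sg).
- have [r' e'] : exists r', eqs K (pbs g s) (gam (pbx g x) r').
    by apply: (f1 _ _ r) => //; [apply: (flat_pbx sg)|apply: (eqx_pbx sg sx)].
  exact: g1 e'.
by apply: (g2 x) => //; apply: (f2 (pbx g x)) => //; [apply: (flat_pbx sg)|apply: (ker_pb sg)].
Qed.

Lemma extending_comp : simplicial f L K ->
  extending f L K -> extending g K N -> extending (g \o f) L N.
Proof.
move=> sf ef eg x fx; have [y [fy yx sy ry]] := ef x fx.
have [z [fz zy sz rz]] := eg y fy; exists z; split=> //.
- by apply: eqx_trans yx; apply: (eqx_pbx sf zy).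
- move=> s /sy [s' /sz[s'' ? e'] e]; exists s'' => //; apply: eqs_trans e.
  exact: (eqs_pbs sf e').
move=> r /ry [r' /rz[r'' ? e'] e]; exists r'' => // u Lu.
by rewrite -e //; apply: e'; apply: (sf _ Lu).
Qed.
End Composition.

Lemma simplicial_id (V : eqType) (L K : pred (seq V)) : subpred L K -> simplicial id L K.
Proof. by move=> sLK S LS; rewrite map_id; apply: sLK. Qed.

Lemma faithful_id (V : eqType) (K : pred (seq V)) : faithful id K K.
Proof. by split=> // x s r fx sx e; exists r. Qed.

Lemma extending_id (V : eqType) (K : pred (seq V)) : extending id K K.
Proof.
move=> x fx; exists x; split=> //.
  by move=> s e; exists s.
by move=> r e; exists r.
Qed.

Section RemoveStar.
Variables (V : eqType) (J : pred (seq V)) (T : seq V) (m : V).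
Hypotheses (mJ : mono J) (T0 : T != [::]) (mT : m \notin T).
Hypothesis dom : forall S, J S -> {subset T <= S} -> J (m :: S).
Local Notation J0 := (remove_star J T).

Lemma sub_remove_star : subpred J0 J.
Proof. by move=> S /andP[]. Qed.

Lemma faithful_remove_star : faithful id J0 J.
Proof.
have m0 := @mono_remove_star _ J T mJ; have sub := sub_remove_star.
split=> [x y fx fy [s e]|x s r fx sx e|x r fx k e].
- have fsx : flat J (gact s x) by apply: flat_gact.
  have [s' _ e'] := remove_star_fibre mJ mT dom fsx fy e.
  by exists (gmul s' s); apply: eqx_trans e'; apply: gactM.
- have fx0 := flat_sub sub fx.
  have ix : eqx J (gact (ginv (gam x r)) x) x.
    apply: eqx_trans (gam_stab (fun u => (r u)^-1) mJ fx).
    by apply: gact_eq => //; apply: gamV.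
  (* Dividing [s] by [gam x r] makes it trivial on [J0], the situation of [remove_star_stab]. *)
  have [||r' _ e'] := @remove_star_stab _ J T m mJ T0 mT dom x (gmul (ginv (gam x r)) s) fx.
  - by apply: eqs_trans (gmulVg _ (gam x r)); apply: gmul_eq.
  - by apply: eqx_trans ix; apply: eqx_trans (gactM _ _ _ _) _; apply: gact_eq.
  exists (fun u => r u * r' u); apply: eqs_trans (gamM _ _ _ _).
  apply: eqs_trans (gmul_eq mJ (eqs_refl _ _) e').
  apply: eqs_sym; apply: eqs_trans (gmulA _ _ _ _) _; apply: eqs_trans (gmul1 _ _).
  by apply: gmul_eq => //; apply: gmulV.
exact: (remove_star_ker mJ T0 mT dom k e).
Qed.

Lemma extending_remove_star : extending id J0 J.
Proof.
have m0 := @mono_remove_star _ J T mJ; have sub := sub_remove_star.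
move=> x fx; have [y fy yx] := remove_star_extend mJ mT dom fx; exists y; split=> //.
- move=> s sx; have fsy : flat J (gact s y) by apply: flat_gact.
  have e : eqx J0 (gact s y) y.
    apply: eqx_trans (eqx_sym yx); apply: eqx_trans sx.
    by apply: gact_eq => //.
  have [s' s'1 e'] := remove_star_fibre mJ mT dom fsy fy e.
  exists (gmul s' s); first by apply: eqx_trans e'; apply: gactM.
  by apply: eqs_trans (gmul1 _ _); apply: gmul_eq.
move=> r k; apply: (remove_star_ker_extend mJ T0 mT dom fy).
have [e _] := yx; case: k => k1 k2; split=> // u v p.
by rewrite e // k2.
Qed.
End RemoveStar.

Definition remove_stars (V : eqType) (J : pred (seq V)) (Ts : seq (seq V)) : pred (seq V) :=
  foldr (fun T J => remove_star J T) J Ts.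

Lemma remove_starsE (V : eqType) (J : pred (seq V)) Ts S :
  remove_stars J Ts S = J S && all (fun T => ~~ all (mem S) T) Ts.
Proof.
elim: Ts => [|T Ts /= IH]; first by rewrite andbT.
by rewrite /remove_star IH -andbA; congr andb; rewrite andbC.
Qed.

Lemma mono_remove_stars (V : eqType) (J : pred (seq V)) Ts :
  mono J -> mono (remove_stars J Ts).
Proof. by move=> mJ; elim: Ts => //= T Ts; apply: mono_remove_star. Qed.

(** The fold deletes from the end of [Ts], hence by decreasing [rho]. At the turn of [T] no simplex
    containing a [T'] of larger [rho] is left, so domination need only hold for the others. Apexes
    outside every [T'] keep the cones among the surviving simplices. *)
Lemma remove_stars_equiv (V : eqType) (J : pred (seq V)) (rho : seq V -> nat)
    (Ts : seq (seq V)) : mono J ->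
  sorted (fun a b => rho a <= rho b) Ts ->
  (forall T, T \in Ts -> T != [::]) ->
  (forall T, T \in Ts -> exists2 m, forall T', T' \in Ts -> m \notin T' &
     forall S, J S -> {subset T <= S} ->
     (forall T', T' \in Ts -> rho T < rho T' -> ~~ all (mem S) T') -> J (m :: S)) ->
  faithful id (remove_stars J Ts) J /\ extending id (remove_stars J Ts) J.
Proof.
move=> mJ; elim: Ts => [|T Ts IH] srt T0 dom.
  by split; [apply: faithful_id|apply: extending_id].
have tr : transitive (fun a b : seq V => rho a <= rho b).
  by move=> b a c; apply: leq_trans.
move: srt; rewrite /= (path_sortedE tr) => /andP[/allP le srt].
have [|T1 i1|F E] := IH srt.
- by move=> T' i; apply: T0; rewrite inE i orbT.
- have [|m aT dT] := dom T1; first by rewrite inE i1 orbT.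
  exists m => [T' i|S jS sub n]; first by apply: aT; rewrite inE i orbT.
  apply: dT => // T2; rewrite inE => /orP[/eqP->|]; last exact: n.
  by rewrite ltnNge le.
have mR := @mono_remove_stars _ J Ts mJ.
have T0' : T != [::] by apply: T0; rewrite inE eqxx.
have [|m aT dm] := dom T; first by rewrite inE eqxx.
have aT' : m \notin T by apply: aT; rewrite inE eqxx.
have dT S : remove_stars J Ts S -> {subset T <= S} -> remove_stars J Ts (m :: S).
  rewrite !remove_starsE => /andP[jS /allP nS] sub; apply/andP; split.
    apply: dm => // T'; rewrite inE => /orP[/eqP->|/nS//]; by rewrite ltnn.
  apply/allP => T' i; apply: contra (nS _ i) => /allP a; apply/allP => v vT'.
  have := a v vT'; rewrite !inE => /orP[/eqP e|//].
  by have := aT T'; rewrite !inE i orbT -e vT' => /(_ isT).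
have sub : subpred (remove_star (remove_stars J Ts) T) (remove_stars J Ts).
  exact: sub_remove_star.
have sub' : subpred (remove_stars J Ts) J by move=> S; rewrite remove_starsE => /andP[].
split.
  apply: (faithful_comp (K := remove_stars J Ts)) F; first exact: simplicial_id.
  exact: (faithful_remove_star mR T0' aT' dT).
apply: (extending_comp (K := remove_stars J Ts)) E; first exact: simplicial_id.
exact: (extending_remove_star mR T0' aT' dT).
Qed.

Section Embedding.
Variables (V W : eqType) (f : V -> W) (k : W -> V).
Variables (L : pred (seq V)) (K : pred (seq W)).
Hypotheses (mK : mono K) (fk : cancel f k).
Hypothesis LK : forall S, L S = K (map f S).
Hypothesis Kf : forall w, K [:: w] -> f (k w) = w.

Lemma embedding_simplicial : simplicial f L K.
Proof. by move=> S; rewrite LK. Qed.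

Lemma embedding_inv_simplicial S : K S -> map f (map k S) = S.
Proof.
move=> kS; rewrite -map_comp -[RHS]map_id; apply/eq_in_map => w wS /=; apply: Kf.
by apply: mK kS => v; rewrite inE => /eqP ->.
Qed.

Lemma embedding_inv S : K S -> L (map k S).
Proof. by move=> kS; rewrite LK embedding_inv_simplicial. Qed.

Lemma embedding_faithful : faithful f L K.
Proof.
have sk : simplicial k K L by move=> S /embedding_inv.
have ex x : eqx K (pbx k (pbx f x)) x.
  split=> [u v|u v w] /embedding_inv_simplicial [] /= -> -> //.
  by move=> ->.
have es s : eqs K (pbs k (pbs f s)) s.
  split=> [u|u v] /embedding_inv_simplicial [] /= -> //.
  by move=> ->.
split=> [x y fx fy [s e]|x s r fx sx e|x r fx kr e].
- exists (pbs k s); apply: eqx_trans (ex y); apply: eqx_trans (eqx_pbx sk e).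
  exact: (gact_eq mK (eqs_refl K (pbs k s)) (eqx_sym (ex x))).
- exists (r \o k); apply: eqs_trans (eqs_sym (es s)) _.
  by apply: eqs_trans (eqs_pbs sk e) (gam_eq (r := r \o k) mK (ex x) _).
by move=> w Kw; rewrite -(Kf Kw); apply: e; rewrite LK /= Kf.
Qed.

Lemma embedding_extending : extending f L K.
Proof.
have sk : simplicial k K L by move=> S /embedding_inv.
move=> x fx; exists (pbx k x); split=> //.
- exact: (flat_pbx sk).
- by split=> *; rewrite /= !fk.
- move=> s sx; exists (pbs k s); first exact: (eqx_pbx sk sx).
  by split=> *; rewrite /= !fk.
move=> r kr; exists (r \o k); first exact: (ker_pb sk).
by move=> u _; rewrite /= fk.
Qed.
End Embedding.

(** Deletion followed by relabelling: what survives of [J] is the image of [L] under [f], with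
    inverse [k] on vertices. The list [Ts] is sorted here, so that applications may give it in any
    order. *)
Lemma collapse_equiv (V W : eqType) (f : V -> W) (k : W -> V)
    (L : pred (seq V)) (J : pred (seq W)) (rho : seq W -> nat) (Ts : seq (seq W)) :
  mono J -> cancel f k ->
  (forall S, L S = J (map f S) && all (fun T => ~~ all (mem (map f S)) T) Ts) ->
  (forall w, J [:: w] -> all (fun T => ~~ all (mem [:: w]) T) Ts -> f (k w) = w) ->
  (forall T, T \in Ts -> T != [::]) ->
  (forall T, T \in Ts -> exists2 m, forall T', T' \in Ts -> m \notin T' &
     forall S, J S -> {subset T <= S} ->
     (forall T', T' \in Ts -> rho T < rho T' -> ~~ all (mem S) T') -> J (m :: S)) ->
  faithful f L J /\ extending f L J.
Proof.
move=> mJ fk LE kE T0 dom; pose le (a b : seq W) := rho a <= rho b.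
pose J0 := remove_stars J (sort le Ts).
have J0E S : J0 S = J S && all (fun T => ~~ all (mem S) T) Ts.
  rewrite /J0 remove_starsE; congr andb; apply: perm_all.
  by rewrite perm_sort.
have [||T|F E] := @remove_stars_equiv _ J rho (sort le Ts) mJ.
- by apply: sort_sorted => a b; apply: leq_total.
- by move=> T; rewrite mem_sort; apply: T0.
- rewrite mem_sort => /dom[m m1 m2]; exists m => [T'|S jS sub n].
    by rewrite mem_sort; apply: m1.
  by apply: m2 => // T' i; apply: n; rewrite mem_sort.
have m0 : mono J0 by apply: mono_remove_stars.
have LE' S : L S = J0 (map f S) by rewrite LE J0E.
have kE' w : J0 [:: w] -> f (k w) = w by rewrite J0E => /andP[]; apply: kE.
have sub : simplicial id J0 J.
  by apply: simplicial_id => S; rewrite J0E => /andP[].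
split.
  exact: (faithful_comp sub (embedding_faithful m0 LE' kE') F).
apply: (extending_comp _ (embedding_extending m0 fk LE' kE') E).
exact: embedding_simplicial.
Qed.

End Gauge.

(** * Barycentric subdivision and contiguity *)

Section Combinatorics.
Variable V : finType.
Notation NE := {S : {set V} | S != finset.set0}.
Implicit Types (P : pred (seq V)).

Lemma ne_pick (S : NE) : exists v, v \in val S.
Proof. by apply/finset.set0Pn; case: S. Qed.
Definition ne_elt (S : NE) : V := xchoose (ne_pick S).
Lemma ne_eltP S : ne_elt S \in val S.
Proof. exact: xchooseP. Qed.

Definition comparable_sets : rel NE := fun S S' => (val S \subset val S') || (val S' \subset val S).
(** The vertex type is all nonempty subsets, and [sd] itself excludes those that are not simplices.
    Hence in iterated subdivisions a point of the vertex type need not be a vertex. *)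
Definition sd P : pred (seq NE) := fun s =>
  all (fun S : NE => P (enum (val S))) s && allrel comparable_sets s s.

Lemma mono_sd P : mono (sd P).
Proof.
move=> s t sub /andP[/allP a /allrelP b]; apply/andP; split.
  by apply/allP => S /sub; apply: a.
by apply/allrelP => S S' /sub ? /sub ?; apply: b.
Qed.

Definition lefts (s : seq (V + NE)) : seq V :=
  pmap (fun a => if a is inl v then Some v else None) s.
Definition rights (s : seq (V + NE)) : seq NE :=
  pmap (fun a => if a is inr v then Some v else None) s.

Lemma mem_lefts s v : (v \in lefts s) = (inl v \in s).
Proof. by elim: s => [//|[u|A] s IH]; rewrite /= !inE IH. Qed.
Lemma mem_rights s v : (v \in rights s) = (inr v \in s).
Proof. by elim: s => [//|[u|A] s IH]; rewrite /= !inE IH. Qed.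

(* The simplices of the mapping cylinder of the subdivision are the
   [t \cup {S_1 < ... < S_k}] with [t] a simplex contained in [S_1]. *)
Definition sd_cyl P : pred (seq (V + NE)) := fun s =>
  [&& P (lefts s), sd P (rights s) & allrel (fun v (S : NE) => v \in val S) (lefts s) (rights s)].

Lemma mono_sd_cyl P : mono P -> mono (sd_cyl P).
Proof.
move=> mP s t sub /and3P[a b /allrelP c]; apply/and3P; split.
- by apply: mP a => v; rewrite !mem_lefts; apply: sub.
- by apply: mono_sd b => v; rewrite !mem_rights; apply: sub.
apply/allrelP => v S; rewrite mem_lefts mem_rights => /sub i /sub j.
by apply: c; rewrite (mem_lefts, mem_rights).
Qed.

Lemma set1_nonempty (v : V) : [set v]%SET != finset.set0.
Proof. by apply/finset.set0Pn; exists v; rewrite inE. Qed.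
Definition ne_of (v : V) : NE := exist _ [set v]%SET (set1_nonempty v).
Definition cyl_ret (a : V + NE) : V := match a with inl v => v | inr A => ne_elt A end.
Definition cyl_ret' (a : V + NE) : NE := match a with inl v => ne_of v | inr A => A end.

(** * The mapping cylinder of the subdivision collapses to both ends *)

Section Equivalences.
Variables (G H : finGroupType) (d : H -> G) (act : G -> H -> H).
Hypothesis cm : crossed_module d act.
Variable P : pred (seq V).
Hypothesis mP : mono P.

Lemma sd_cyl_inl S : sd_cyl P (map inl S) = P S.
Proof.
rewrite /sd_cyl; have -> : lefts (map inl S) = S by elim: S => //= v S ->.
have -> : rights (map inl S) = [::] by elim: S.
by rewrite /= allrel0r !andbT.
Qed.

Lemma sd_cyl_inr S : P [::] -> sd_cyl P (map inr S) = sd P S.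
Proof.
move=> P0; rewrite /sd_cyl.
have -> : lefts (map inr S) = [::] by elim: S.
have -> : rights (map inr S) = S by elim: S => //= v S ->.
by rewrite P0 /= andbT.
Qed.

(** The vertices [inr S] are deleted, smaller [S] first. In a remaining simplex [S] is then the
    smallest set, so any vertex of [S] can be joined to it. *)
Lemma sd_cyl_base_equiv :
  faithful d act inl P (sd_cyl P) /\ extending d act inl P (sd_cyl P).
Proof.
pose Ts : seq (seq (V + NE)) := [seq [:: inr A] | A : NE <- enum {: NE}].
(* Larger [rho] goes first, whence the complement of the cardinality; the sum merely reads off [S]
   from [[:: inr S]]. *)
pose rho (T : seq (V + NE)) := #|V| - (\sum_(A <- rights T) #|val A|).
have rhoE S : rho [:: inr S] = #|V| - #|val S| by rewrite /rho /= big_seq1.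
apply: (collapse_equiv cm (k := cyl_ret) (rho := rho) (Ts := Ts)).
- exact: mono_sd_cyl.
- by [].
- move=> S; rewrite sd_cyl_inl; case: (P S) => //=; apply/esym/allP => T.
  by case/mapP => S' _ -> /=; rewrite andbT; apply/negP => /mapP[].
- move=> [v|A] // _ /allP /(_ [:: inr A]); rewrite /= inE eqxx /=.
  by move=> h; exfalso; move: h => /(_ _); rewrite map_f ?mem_enum // => /(_ isT).
- by move=> T /mapP[S _ ->].
move=> T /mapP[S _ ->]; exists (inl (ne_elt S)) => [T' /mapP[S' _ ->]|]; first by rewrite inE.
move=> s /and3P[a b c] sub big.
have Ss : S \in rights s by rewrite mem_rights; apply: sub; rewrite inE.
have min S' : S' \in rights s -> val S \subset val S'.
  move=> i; move: b => /andP[_ /allrelP /(_ _ _ Ss i) /orP[//|SS']].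
  have [e|ne] := eqVneq (val S) (val S'); first by rewrite e.
  have lt : #|val S'| < #|val S|.
    by rewrite proper_card // finset.properEneq eq_sym ne.
  have := big [:: inr S']; rewrite map_f ?mem_enum // !rhoE => /(_ isT).
  rewrite /= -mem_rights i => /(_ _) /negP.
  have le := max_card (mem (val S)); case=> //.
  by apply: ltn_sub2l => //; apply: leq_trans le.
have lS v : v \in lefts s -> v \in val S.
  by move=> i; apply: (allrelP c).
apply/and3P; split=> //=.
- apply: (mP (s := enum (val S))).
    by move=> v; rewrite inE mem_enum => /orP[/eqP->|/lS//]; apply: ne_eltP.
  by move: b => /andP[/allP /(_ _ Ss)].
apply/allrelP => v S'; rewrite inE => /orP[/eqP->|i] j; last exact: (allrelP c).
exact: (fintype.subsetP (min _ j)) (ne_eltP S).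
Qed.

(** Base faces [A] are deleted, larger ones first. The base part of a remaining simplex containing
    [A] is then exactly [A], so [inr A] can be joined to it. *)
Lemma sd_cyl_sd_equiv : P [::] ->
  faithful d act inr (sd P) (sd_cyl P) /\ extending d act inr (sd P) (sd_cyl P).
Proof.
move=> P0.
pose Ts : seq (seq (V + NE)) := [seq map inl (enum (val A)) | A : NE <- enum {: NE}].
apply: (collapse_equiv cm (k := cyl_ret') (rho := size) (Ts := Ts)).
- exact: mono_sd_cyl.
- by [].
- move=> S; rewrite sd_cyl_inr //; case: (sd P S) => //=; apply/esym/allP => T.
  case/mapP => S' _ ->; apply/allPn; exists (inl (ne_elt S')).
    by rewrite map_f // mem_enum ne_eltP.
  by apply/negP => /mapP[].
- move=> [v|A] // _ /allP /(_ [:: inl v]).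
  have -> : [:: inl v] \in Ts.
    by apply/mapP; exists (ne_of v); rewrite ?mem_enum //= enum_set1.
  by rewrite /= inE eqxx => /(_ isT).
- move=> T /mapP[S _ ->]; have := ne_eltP S; rewrite -mem_enum.
  by case: (enum _).
move=> T /mapP[S _ ->]; exists (inr S) => [T' /mapP[S' _ ->]|]; first by apply/negP => /mapP[].
move=> s /and3P[a b c] sub big.
have Sl v : v \in val S -> v \in lefts s.
  by move=> i; rewrite mem_lefts; apply: sub; rewrite map_f // mem_enum.
pose S1 := [set v in lefts s].
have S10 : S1 != finset.set0.
  by apply/finset.set0Pn; exists (ne_elt S); rewrite inE Sl // ne_eltP.
have SS1 : val S \subset S1 by apply/fintype.subsetP => v /Sl; rewrite inE.
have eS : val S = S1.
  apply/eqP; rewrite finset.eqEcard SS1 leqNgt; apply/negP => lt.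
  have i1 : map inl (enum S1) \in Ts.
    by apply/mapP; exists (exist _ S1 S10); rewrite ?mem_enum.
  have := big _ i1; rewrite !size_map -!cardE => /(_ lt) /negP; apply.
  by apply/allP => _ /mapP[v + ->]; rewrite mem_enum !inE mem_lefts.
have lS v : v \in lefts s -> v \in val S by rewrite eS inE.
have Pe : P (enum (val S)) by apply: mP a => v; rewrite mem_enum => /Sl.
have Sr S' : S' \in rights s -> val S \subset val S'.
  by move=> i; apply/fintype.subsetP => v /Sl j; apply: (allrelP c).
apply/and3P; split=> //=.
- move: b => /andP[b1 b2]; rewrite /sd /= Pe b1 /=.
  apply/allrelP => A B; rewrite !inE => /orP[/eqP->|i] /orP[/eqP->|j].
  + by rewrite /comparable_sets fintype.subxx.
  + by rewrite /comparable_sets Sr.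
  + by rewrite /comparable_sets Sr // orbT.
  exact: (allrelP b2).
by apply/allrelP => v S' i; rewrite inE => /orP[/eqP->|j]; [apply: lS|apply: (allrelP c)].
Qed.

(** If sets occur, the whole image lies in the largest of them, which is a simplex of [P]. *)
Lemma cyl_ret_simplicial : simplicial cyl_ret (sd_cyl P) P.
Proof.
move=> s /and3P[a b c]; have [e|[S0 i0]] : rights s = [::] \/ exists S, S \in rights s.
  by case: (rights s) => [|S l]; [left|right; exists S; rewrite inE eqxx].
  apply: mP a => v /mapP[[u|A] i ->]; rewrite mem_lefts //.
  by move: i; rewrite -mem_rights e.
have [M iM max] : exists2 S, S \in rights s & forall S', S' \in rights s -> val S' \subset val S.
  case: (arg_maxnP (P := fun S => S \in rights s) (fun S : NE => #|val S|) i0) => M iM max.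
  exists M => // S' i; move: b => /andP[_ /allrelP /(_ _ _ i iM) /orP[//|MS']].
  have := max _ i; rewrite /= => le.
  by have /eqP -> : val M == val S' by rewrite finset.eqEcard MS'.
move: b => /andP[/allP /(_ _ iM) PM _]; apply: mP PM => v /mapP[[u|A] i ->]; rewrite mem_enum.
  by apply: (allrelP c); rewrite ?mem_lefts.
by apply: (fintype.subsetP (max A _)); rewrite ?mem_rights // ne_eltP.
Qed.


(** [ne_elt] is [inr] followed by [cyl_ret], and [cyl_ret] is faithful because it is the identity on
    the base. *)
Lemma ne_elt_faithful : P [::] -> faithful d act ne_elt (sd P) P.
Proof.
move=> P0; have [F _] := sd_cyl_sd_equiv P0.
apply: (faithful_comp (f := inr) (g := cyl_ret) cyl_ret_simplicial F).
apply: (faithful_left (f := inl) (L := P)); last exact: faithful_id.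
by move=> S; rewrite sd_cyl_inl.
Qed.

End Equivalences.

(** * Contiguous maps *)

Section Contiguity.
Variables (G H : finGroupType) (d : H -> G) (act : G -> H -> H).
Hypothesis cm : crossed_module d act.
Variable P : pred (seq V).
Hypothesis mP : mono P.

(** Not a triangulated product: over each simplex the vertices of both copies span a single simplex.
    A pair of contiguous maps is thus simplicial on it, whatever the vertex order. *)
Definition prism : pred (seq (V * bool)) := fun s => P (map fst s).
Lemma mono_prism : mono prism.
Proof.
move=> s t sub; apply: mP => v /mapP[u /sub i ->].
exact: map_f.
Qed.

(** Each vertex [(v, ~~ b)] is dominated by [(v, b)]. *)
Lemma prism_end_faithful b : faithful d act (fun v => (v, b)) P prism.
Proof.
pose Ts : seq (seq (V * bool)) := [seq [:: (v, ~~ b)] | v <- enum V].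
suff [] : faithful d act (fun v => (v, b)) P prism /\ extending d act (fun v => (v, b)) P prism by [].
apply: (collapse_equiv cm (k := fst) (rho := size) (Ts := Ts)).
- exact: mono_prism.
- by [].
- move=> S; rewrite /prism -map_comp map_id; case: (P S) => //=.
  apply/esym/allP => T /mapP[v _ ->] /=; rewrite andbT; apply/negP => /mapP[u _ [_]].
  by case: (b).
- move=> [v b'] _ /allP /(_ [:: (v, ~~ b)]); rewrite map_f ?mem_enum // => /(_ isT).
  by rewrite /= inE andbT xpair_eqE eqxx /=; case: (b); case: b'.
- by move=> T /mapP[v _ ->].
move=> T /mapP[v _ ->]; exists (v, b) => [T' /mapP[v' _ ->]|S jS sub _].
  by rewrite inE xpair_eqE; case: (b); rewrite andbF.
apply: mP jS => u; rewrite /= inE => /orP[/eqP->|//].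
by apply: (map_f fst (x := (v, ~~ b))); apply: sub; rewrite inE.
Qed.

(** The map [h] on the prism restricts to [f] and [g] at its ends. Faithfulness passes from [f] to
    [h] by [faithful_left], and from [h] to [g] because the end inclusion is faithful. *)
Lemma contiguous_faithful (W : eqType) (K : pred (seq W)) (f g : V -> W) :
  (forall S, P S -> K (map f S ++ map g S)) -> mono K ->
  faithful d act f P K -> faithful d act g P K.
Proof.
move=> fg mK F; pose h (a : V * bool) := if a.2 then g a.1 else f a.1.
have sh : simplicial h prism K.
  move=> S /fg; apply: mK => w /mapP[[v b] i ->]; rewrite /h /= mem_cat.
  by case: b i => i; rewrite ?(map_f f) ?(map_f g) ?orbT //; apply: (map_f fst i).
have si : simplicial (fun v => (v, false)) P prism.
  by move=> S; rewrite /prism -map_comp map_id.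
have Fh : faithful d act h prism K by apply: (faithful_left si F).
exact: (faithful_comp sh (prism_end_faithful true) Fh).
Qed.
End Contiguity.

End Combinatorics.

(** * Homotopy cardinality *)

Section Classes.
Variables (T : finType) (A : pred T) (e : rel T).

Definition equiv_on := [/\ forall x, A x -> e x x,
  forall x y, A x -> A y -> e x y -> e y x
  & forall x y z, A x -> A y -> A z -> e x y -> e y z -> e x z].

(** The pick depends only on the class as a predicate, so related elements get the same
    representative. *)
Definition crep (x : T) : T := odflt x [pick y | A y && e x y].
Definition creps : {set T} := [set x | A x && (crep x == x)]%SET.
Definition ncl := #|creps|.

Hypothesis eqv : equiv_on.

Lemma crepP x : A x -> A (crep x) && e x (crep x).
Proof.
case: eqv => r _ _ Ax; rewrite /crep; case: pickP => [y //|/(_ x)].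
by rewrite Ax r.
Qed.

Lemma crep_eq x y : A x -> A y -> e x y -> crep x = crep y.
Proof.
case: eqv => r s t Ax Ay xy; rewrite /crep.
have E : (fun z => A z && e x z) =1 (fun z => A z && e y z).
  move=> z; case Az : (A z) => //=; apply/idP/idP => h; last exact: t h.
  by apply: t h => //; apply: s.
rewrite (eq_pick E); case: pickP => // /(_ y); by rewrite Ay r.
Qed.

Lemma crep_rel x y : A x -> A y -> crep x = crep y -> e x y.
Proof.
move=> Ax Ay E; case: eqv => r s t.
have /andP[a b] := crepP Ax; have /andP[a' b'] := crepP Ay.
by apply: (t _ (crep x)) => //; rewrite E; apply: s.
Qed.

Lemma crep_in x : A x -> crep x \in creps.
Proof.
move=> Ax; have /andP[a b] := crepP Ax; rewrite inE a /=.
by apply/eqP/esym/crep_eq.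
Qed.

Lemma sum_classes (R : nmodType) (F : T -> R) :
  (\sum_(x | A x) F x = \sum_(x in creps) \sum_(y | A y && e x y) F y)%R.
Proof.
rewrite (partition_big crep (mem creps)) /=; last by move=> x /crep_in.
apply: eq_bigr => x; rewrite inE => /andP[Ax /eqP cx]; apply: eq_bigl => y.
case Ay : (A y) => //=; apply/eqP/idP => [E|xy].
  by apply: crep_rel => //; rewrite cx.
by rewrite -(crep_eq Ax Ay xy).
Qed.

Lemma card_sum_classes : #|A| = (\sum_(x in creps) #|[pred y | A y && e x y]|)%N.
Proof.
rewrite -sum1_card (sum_classes (fun=> 1%N)).
by apply: eq_bigr => x _; rewrite sum1_card.
Qed.

Lemma card_classes k : (forall x, A x -> #|[pred y | A y && e x y]| = k) ->
  #|A| = (ncl * k)%N.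
Proof.
move=> ck; rewrite card_sum_classes /ncl.
rewrite (eq_bigr (fun=> k)) ?sum_nat_const // => x; rewrite inE => /andP[Ax _].
by rewrite ck.
Qed.
End Classes.

Lemma ncl_le (T T' : finType) (A : pred T) (e : rel T) (B : pred T') (e' : rel T')
    (f : T -> T') : equiv_on A e -> equiv_on B e' ->
  (forall x, A x -> B (f x)) ->
  (forall x y, A x -> A y -> e' (f x) (f y) -> e x y) -> ncl A e <= ncl B e'.
Proof.
move=> eA eB AB ee.
have inj : {in creps A e &, injective (fun x => crep B e' (f x))}.
  move=> x y; rewrite !inE => /andP[Ax /eqP cx] /andP[Ay /eqP cy] E.
  rewrite -cx -cy; apply: crep_eq => //; apply: ee => //.
  by apply: (crep_rel eB) => //; apply: AB.
rewrite /ncl -(card_in_imset inj); apply: subset_leq_card.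
apply/fintype.subsetP => _ /imsetP[x + ->]; rewrite inE => /andP[Ax _].
by apply: crep_in => //; apply: AB.
Qed.

Lemma double_count (A B : finType) (pA : pred A) (pB : pred B) (R : A -> B -> bool) k l :
  (forall a, pA a -> #|[pred b | pB b && R a b]| = k) ->
  (forall b, pB b -> #|[pred a | pA a && R a b]| = l) ->
  (#|pA| * k = #|pB| * l)%N.
Proof.
move=> hA hB; rewrite -!sum_nat_const.
rewrite -(eq_bigr _ hA) -(eq_bigr _ hB).
under eq_bigr do rewrite -sum1_card big_mkcondr /=.
under [RHS]eq_bigr do rewrite -sum1_card big_mkcondr /=.
exact: exchange_big.
Qed.

Lemma card_agree (T R : finType) (A : pred T) (z : T -> R) :
  #|[pred f : {ffun T -> R} | [forall t, A t ==> (f t == z t)]]| = (#|R| ^ #|predC A|)%N.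
Proof.
pose F t : pred R := if A t then pred1 (z t) else predT.
rewrite (eq_card (B := mem (family F))); last first.
  move=> f; rewrite !inE; apply/forallP/familyP => h t; have := h t; rewrite /F.
    by case: (A t) => /=; rewrite inE.
  by case: (A t) => /=; rewrite inE.
rewrite card_family.
have -> : foldr muln 1 [seq #|F x| | x : T] = (\prod_(x : T) #|F x|)%N.
  by rewrite foldrE big_map big_enum.
rewrite (bigID A) /= big1 ?mul1n; last by move=> t At; rewrite /F At card1.
rewrite (eq_bigr (fun=> #|R|)); last by move=> t /negPf nt; rewrite /F nt.
by rewrite prod_nat_const.
Qed.

(** Quotients are not monotone, so [n1] and [n2] are treated apart. The injections are bijective by
    cardinality, and going round through [f] and [g] squeezes the sum of each weight between itself
    and itself, so every termwise inequality is an equality. *)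
Lemma mutual_embedding_sum (T T' : finType) (A : {set T}) (B : {set T'})
    (f : T -> T') (g : T' -> T) (n1 n2 : T -> nat) (m1 m2 : T' -> nat) :
  {in A &, injective f} -> {in B &, injective g} ->
  (forall x, x \in A -> [/\ f x \in B, n1 x <= m1 (f x) & n2 x <= m2 (f x)]) ->
  (forall y, y \in B -> [/\ g y \in A, m1 y <= n1 (g y) & m2 y <= n2 (g y)]) ->
  (\sum_(x in A) (n2 x)%:R / (n1 x)%:R = \sum_(y in B) (m2 y)%:R / (m1 y)%:R :> rat)%R.
Proof.
move=> fi gi fA gB.
have fAB : (f @: A \subset B)%SET.
  by apply/fintype.subsetP => _ /imsetP[x /fA[h _ _] ->].
have gBA : (g @: B \subset A)%SET.
  by apply/fintype.subsetP => _ /imsetP[x /gB[h _ _] ->].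
have eB : (f @: A = B)%SET.
  apply/eqP; rewrite finset.eqEcard fAB card_in_imset // -(card_in_imset gi).
  exact: subset_leq_card.
have key (n : T -> nat) (m : T' -> nat) : (forall x, x \in A -> n x <= m (f x)) ->
    (forall y, y \in B -> m y <= n (g y)) -> forall x, x \in A -> n x = m (f x).
  move=> nm mn x xA; apply/eqP.
  have h := leqif_sum (fun x (i : x \in A) => leqif_eq (nm x i)).
  have : (\sum_(x in A) n x == \sum_(x in A) m (f x))%N.
    rewrite eqn_leq; apply/andP; split; first by apply: leq_sum.
    rewrite -(big_imset m fi) /= eB.
    apply: (leq_trans (n := \sum_(y in B) n (g y))); first by apply: leq_sum.
    rewrite -(big_imset n gi) /= [leqRHS](big_setID (g @: B)%SET) /=.
    by rewrite (finset.setIidPr gBA) leq_addr.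
  by rewrite h => /forallP /(_ x); rewrite xA.
rewrite -eB big_imset //=; apply: eq_bigr => x xA.
rewrite (key n1 m1) ?(key n2 m2) // => y yB; by [case: (fA y yB)|case: (gB y yB)].
Qed.

Section Counting.
Variables (G H : finGroupType) (d : H -> G) (act : G -> H -> H).
Hypothesis cm : crossed_module d act.

Section FiniteTypes.
Variable V : finType.

(** Finite copies of [col] and [gau], on which cardinalities make sense; [tox], [frx] and [tos],
    [frs] translate. *)
Definition fcol := ({ffun V * V -> G} * {ffun V * V * V -> H})%type.
Definition fgau := ({ffun V -> G} * {ffun V * V -> H})%type.
Definition tox (x : fcol) : col G H V := (fun u v => x.1 (u, v), fun u v w => x.2 (u, v, w)).
Definition tos (s : fgau) : gau G H V := (fun u => s.1 u, fun u v => s.2 (u, v)).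
Definition frx (x : col G H V) : fcol :=
  ([ffun p => x.1 p.1 p.2], [ffun p => x.2 p.1.1 p.1.2 p.2]).
Definition frs (s : gau G H V) : fgau := ([ffun u => s.1 u], [ffun p => s.2 p.1 p.2]).

Lemma tox_frx P x : eqx P (tox (frx x)) x.
Proof. by split=> *; rewrite /= ffunE. Qed.
Lemma frx_tox P x : eqx P x (tox (frx x)).
Proof. by split=> *; rewrite /= ffunE. Qed.
Lemma tos_frs P s : eqs P (tos (frs s)) s.
Proof. by split=> *; rewrite /= ffunE. Qed.
Lemma frs_tos P s : eqs P s (tos (frs s)).
Proof. by split=> *; rewrite /= ffunE. Qed.

Variable P : pred (seq V).
Hypothesis mP : mono P.
Implicit Types (x y : col G H V).

Definition flatb (x : fcol) : bool := `[< flat d act P (tox x) >].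
Definition relb (x y : fcol) : bool := `[< gtrel d act P (tox x) (tox y) >].
Definition stabb x (s : fgau) : bool := `[< eqx P (gact d act (tos s) x) x >].
(** Taking [r = 1] shows that this also identifies gauge transformations differing only off [P]. *)
Definition congb x (s t : fgau) : bool :=
  `[< exists r, eqs P (tos t) (gmul act (tos s) (gam d act x r)) >].
Definition kerb x (r : {ffun V -> H}) : bool := `[< ker d act P x r >].
Definition eqrb (r r' : {ffun V -> H}) : bool := `[< eqr P r r' >].

(* The orders of [pi_1] (stabiliser of [x] modulo 2-gauge transformations) and [pi_2] of the
   component of [x]. *)
Definition npi1 x := ncl (stabb x) (congb x).
Definition npi2 x := ncl (kerb x) eqrb.

Lemma relb_equiv : equiv_on flatb relb.
Proof.
split=> [x _|x y _ _ /asboolP h|x y z _ _ _ /asboolP h /asboolP h']; apply/asboolP.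
- by apply: gtrel_eqx.
- exact: (gtrel_sym cm mP).
exact: (gtrel_trans cm mP h h').
Qed.

Lemma congb_equiv x : equiv_on (stabb x) (congb x).
Proof.
split=> [s _|s t _ _ /asboolP[r e]|s t u _ _ _ /asboolP[r e] /asboolP[r' e']]; apply/asboolP.
- exists (fun=> 1%g); apply: eqs_sym; apply: eqs_trans (gmulg1 cm _ _).
  by apply: gmul_eq => //; apply: (gam1 cm).
- exists (fun u => (r u)^-1)%g.
  apply: eqs_sym; apply: eqs_trans (gmul_eq act mP e (eqs_sym (gamV cm _ _ _))) _.
  apply: eqs_trans (eqs_sym (gmulA cm _ _ _ _)) _; apply: eqs_trans (gmulg1 cm _ _).
  by apply: gmul_eq => //; apply: (gmulV cm).
exists (fun u => r u * r' u)%g; apply: eqs_trans e' _.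
apply: eqs_trans (gmul_eq act mP e (eqs_refl _ _)) _.
apply: eqs_trans (eqs_sym (gmulA cm _ _ _ _)) _.
by apply: gmul_eq => //; apply: (gamM cm).
Qed.

Lemma eqrb_equiv x : equiv_on (kerb x) eqrb.
Proof.
split=> [r _|r s _ _ /asboolP h|r s t _ _ _ /asboolP h /asboolP h']; apply/asboolP => //.
  by move=> u p; rewrite h.
by move=> u p; rewrite h // h'.
Qed.

Lemma npi1_gt0 x : 0 < npi1 x.
Proof.
apply/card_gt0P; exists (crep (stabb x) (congb x) (frs (gone G H V))).
apply: (crep_in (congb_equiv x)); apply/asboolP.
apply: eqx_trans (gact1 cm P x); apply: gact_eq => //.
exact: tos_frs.
Qed.
End FiniteTypes.

(** * Comparing classes, pi_1 and pi_2 of two complexes *)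

Section Compare.
Variables (V W : finType) (P : pred (seq V)) (Q : pred (seq W)).
Hypotheses (mP : mono P) (mQ : mono Q).

Lemma npi1_le (x : col G H V) (y : col G H W) (f : gau G H V -> gau G H W) :
  (forall s, eqx P (gact d act s x) x -> eqx Q (gact d act (f s) y) y) ->
  (forall s t r, eqx P (gact d act s x) x -> eqx P (gact d act t x) x ->
     eqs Q (f t) (gmul act (f s) (gam d act y r)) ->
     exists r, eqs P t (gmul act s (gam d act x r))) ->
  npi1 P x <= npi1 Q y.
Proof.
move=> h1 h2; apply: (ncl_le (f := fun s => frs (f (tos s)))).
- exact: congb_equiv.
- exact: congb_equiv.
- move=> s /asboolP /h1 h; apply/asboolP; apply: eqx_trans h.
  by apply: gact_eq => //; apply: tos_frs.
move=> s t /asboolP hs /asboolP ht /asboolP[r e]; apply/asboolP.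
apply: (h2 _ _ r) => //; apply: eqs_trans (frs_tos _ _) _; apply: eqs_trans e _.
by apply: gmul_eq => //; apply: tos_frs.
Qed.

Lemma npi2_le (x : col G H V) (y : col G H W) (f : (V -> H) -> (W -> H)) :
  (forall r, ker d act P x r -> ker d act Q y (f r)) ->
  (forall r r', ker d act P x r -> ker d act P x r' -> eqr Q (f r) (f r') -> eqr P r r') ->
  npi2 P x <= npi2 Q y.
Proof.
move=> h1 h2; apply: (ncl_le (f := fun r : {ffun V -> H} => [ffun w => f r w])).
- exact: eqrb_equiv.
- exact: eqrb_equiv.
- move=> r /asboolP /h1 [k1 k2]; apply/asboolP; split=> *; rewrite !ffunE ?k1 ?k2 //.
move=> r r' /asboolP k /asboolP k' /asboolP e; apply/asboolP; apply: h2 => // u p.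
by have := e u p; rewrite !ffunE.
Qed.
End Compare.

(** A gauge transformation [s0] from [x] to [y] carries pi_1 over by conjugation and pi_2 by the
    action of [s0.1]. *)
Lemma npi_gtrel (V : finType) (P : pred (seq V)) (x y : col G H V) : mono P ->
  gtrel d act P x y -> npi1 P x <= npi1 P y /\ npi2 P x <= npi2 P y.
Proof.
move=> mP [s0 e0]; split.
  apply: (npi1_le mP mP (f := fun s => gmul act s0 (gmul act s (ginv act s0)))).
    move=> s hs; apply: (eqx_trans _ e0).
    apply: eqx_trans (gactM cm _ _ _ _) _; apply: gact_eq => //.
    apply: eqx_trans hs; apply: eqx_trans (gactM cm _ _ _ _) _; apply: gact_eq => //.
    apply: eqx_trans (gact1 cm P x).
    apply: eqx_trans (gact_eq d act mP (gmulVg cm P s0) (eqx_refl P x)).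
    apply: eqx_trans (eqx_sym (gactM cm _ _ _ _)).
    exact: (gact_eq d act mP (eqs_refl P (ginv act s0)) (eqx_sym e0)).
  (* By [gamJ], moving [gam y r] past the inverse of [s0] applies that inverse to [r]. *)
  move=> s t r hs ht e; exists (fun u => act ((ginv act s0).1 u) (r u)).
  pose a := ginv act s0.
  have ex : eqx P (gact d act a y) x.
    apply: eqx_trans (gact1 cm P x).
    apply: eqx_trans (gact_eq d act mP (gmulVg cm P s0) (eqx_refl P x)).
    apply: eqx_trans (eqx_sym (gactM cm _ _ _ _)).
    exact: (gact_eq d act mP (eqs_refl P (ginv act s0)) (eqx_sym e0)).
  have ta : eqs P (gmul act t a) (gmul act (gmul act s a) (gam d act y r)).
    apply: eqs_trans (eqs_sym (gmul1 cm _ _)) _.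
    apply: eqs_trans (gmul_eq act mP (eqs_sym (gmulVg cm P s0)) (eqs_refl _ _)) _.
    apply: eqs_trans (eqs_sym (gmulA cm _ _ _ _)) _.
    apply: eqs_trans (gmul_eq act mP (eqs_refl P a) e) _.
    apply: eqs_trans (gmulA cm _ _ _ _) _; apply: gmul_eq => //.
    apply: eqs_trans (gmulA cm _ _ _ _) _; apply: eqs_trans (gmul1 cm _ _).
    by apply: gmul_eq => //; apply: (gmulVg cm).
  have : eqs P (gmul act (gmul act t a) s0) t.
    apply: eqs_trans (eqs_sym (gmulA cm _ _ _ _)) _; apply: eqs_trans (gmulg1 cm _ _).
    by apply: gmul_eq => //; apply: (gmulVg cm).
  move/eqs_sym => h; apply: eqs_trans h _.
  apply: eqs_trans (gmul_eq act mP ta (eqs_refl _ _)) _.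
  apply: eqs_trans (eqs_sym (gmulA cm _ _ _ _)) _.
  apply: eqs_trans (eqs_sym (gmulA cm _ _ _ _)) _; apply: gmul_eq => //.
  apply: eqs_trans (gmulA cm _ _ _ _) _.
  apply: eqs_trans (gmul_eq act mP (gamJ cm P y a r) (eqs_refl _ _)) _.
  apply: eqs_trans (eqs_sym (gmulA cm _ _ _ _)) _.
  apply: eqs_trans (gmul_eq act mP (eqs_refl _ _) (gmulVg cm P s0)) _.
  apply: eqs_trans (gmulg1 cm _ _) _.
  by apply: gam_eq => //.
apply: (npi2_le (f := fun r u => act (s0.1 u) (r u))).
  move=> r [k1 k2]; have [e1 _] := e0; split=> [u p|u v p].
    by rewrite (cm_dact cm) k1 // mulg1 mulgV.
  have pv : P [:: v] by apply: (mono_sub mP _ p); rewrite /= !inE eqxx orbT.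
  rewrite -e1 //= !(cm_actA cm) (cm_actKV cm) k2 // (cm_peif cm) (cm_central cm) //.
  by rewrite (cm_dact cm) k1 // mulg1 mulgV.
move=> r r' _ _ e u p; have /(congr1 (act (s0.1 u)^-1)%g) := e u p.
by rewrite !(cm_actKV cm).
Qed.

Lemma npi_gtrel_eq (V : finType) (P : pred (seq V)) (x y : col G H V) : mono P ->
  gtrel d act P x y -> npi1 P x = npi1 P y /\ npi2 P x = npi2 P y.
Proof.
move=> mP xy; have [a b] := npi_gtrel mP xy.
have [a' b'] := npi_gtrel mP (gtrel_sym cm mP xy).
by split; apply/eqP; rewrite eqn_leq ?a ?b ?a' ?b'.
Qed.

(** Stated for a map of colourings, not of vertices, so that pullback along a faithful map and
    extension along an extending map, which go in opposite directions, can be composed. *)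
Definition dominated (V W : finType) (P : pred (seq V)) (Q : pred (seq W)) :=
  exists F : fcol V -> fcol W, forall x, flatb P x ->
    [/\ flatb Q (F x), forall y, flatb P y -> relb Q (F x) (F y) -> relb P x y,
        npi1 P (tox x) <= npi1 Q (tox (F x)) & npi2 P (tox x) <= npi2 Q (tox (F x))].

Lemma dominated_trans (V W U : finType) (P : pred (seq V)) (Q : pred (seq W))
    (N : pred (seq U)) : dominated P Q -> dominated Q N -> dominated P N.
Proof.
move=> [f hf] [g hg]; exists (g \o f) => x fx.
have [fy iy a b] := hf _ fx; have [fz iz a' b'] := hg _ fy.
split=> //; [|exact: leq_trans a'|exact: leq_trans b'].
by move=> y fy' r; apply: iy => //; apply: iz => //; have [] := hf y fy'.
Qed.

Lemma faithful_dominated (V W : finType) (f : V -> W) (L : pred (seq V)) (K : pred (seq W)) :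
  mono L -> mono K -> simplicial f L K -> faithful d act f L K -> dominated K L.
Proof.
move=> mL mK sf [f0 f1 f2]; exists (fun x => frx (pbx f (tox x))) => x /asboolP fx.
have [-> ->] := npi_gtrel_eq mL (gtrel_eqx cm (tox_frx L (pbx f (tox x)))).
split.
- by apply/asboolP; apply: (flat_eqx mL (frx_tox _ _)); apply: (flat_pbx sf).
- move=> y /asboolP fy /asboolP r; apply/asboolP; apply: f0 => //.
  apply: (gtrel_trans cm mL (gtrel_eqx cm (frx_tox _ _))).
  by apply: (gtrel_trans cm mL r); apply: (gtrel_eqx cm (tox_frx _ _)).
- apply: (npi1_le mK mL (f := pbs f)) => [s hs|s t r hs ht e].
    exact: (eqx_pbx sf hs).
  (* Faithfulness speaks of the kernel on pi_1, so it is applied to the quotient of [t] by [s]; pi_2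
     is treated likewise below. *)
  have [||r' e'] := f1 (tox x) (gmul act (ginv act s) t) r fx.
  + apply: eqx_trans (gactM cm _ _ _ _) _; apply: eqx_trans (gact1 cm K _).
    apply: eqx_trans (gact_eq d act mK (gmulVg cm K s) (eqx_refl K _)).
    apply: eqx_trans (eqx_sym (gactM cm _ _ _ _)); apply: gact_eq => //.
    by apply: eqx_trans ht (eqx_sym hs).
  + apply: eqs_trans (gmul_eq act mL (eqs_refl L (ginv act (pbs f s))) e) _.
    apply: eqs_trans (gmulA cm _ _ _ _) _; apply: eqs_trans (gmul1 cm _ _).
    by apply: gmul_eq => //; apply: (gmulVg cm).
  exists r'; apply: eqs_sym.
  apply: eqs_trans (gmul_eq act mK (eqs_refl K s) (eqs_sym e')) _.
  apply: eqs_trans (gmulA cm _ _ _ _) _; apply: eqs_trans (gmul1 cm _ _).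
  by apply: gmul_eq => //; apply: (gmulV cm).
apply: (npi2_le (f := fun r => r \o f)) => [r k|r r' k k' e].
  exact: (ker_pb sf k).
have kk : ker d act K (tox x) (fun u => (r u)^-1 * r' u)%g.
  case: k k' => [k1 k2] [k1' k2']; split=> [u p|u v p].
    by rewrite (cm_dM cm) (cm_dV cm) k1 // k1' // invg1 mulg1.
  by rewrite (cm_actM cm) (cm_actV cm) k2 // k2'.
have h : eqr K (fun u => (r u)^-1 * r' u)%g (fun=> 1%g).
  apply: (f2 _ _ fx kk) => u p; have := e u p => /= ->.
  by rewrite mulVg.
by move=> u p; apply: (mulgI (r u)^-1%g); rewrite mulVg; apply/esym/h.
Qed.

(** Extensions of colourings, stabilisers and pi_2 are chosen arbitrarily; restriction along [f]
    undoes each choice, which yields all the injectivity needed. *)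
Lemma extending_dominated (V W : finType) (f : V -> W) (L : pred (seq V)) (K : pred (seq W)) :
  mono L -> mono K -> simplicial f L K -> extending d act f L K -> dominated L K.
Proof.
move=> mL mK sf ex.
have /choice [F hF] (x : fcol V) : exists y : fcol W, flatb L x ->
    [/\ flatb K y, eqx L (pbx f (tox y)) (tox x), npi1 L (tox x) <= npi1 K (tox y)
      & npi2 L (tox x) <= npi2 K (tox y)].
  case fx : (flatb L x); last by exists (frx (triv G H W)).
  have [y [fy yx sy ry]] := ex _ (asboolW fx); exists (frx y) => _.
  have [-> ->] := npi_gtrel_eq mK (gtrel_eqx cm (tox_frx K y)); split.
  - by apply/asboolP; apply: (flat_eqx mK (frx_tox _ _)).
  - by apply: eqx_trans yx; apply: (eqx_pbx sf (tox_frx _ _)).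
  - have /choice [S hS] (s : gau G H V) : exists s' : gau G H W,
      eqx L (gact d act s (tox x)) (tox x) ->
      eqx K (gact d act s' y) y /\ eqs L (pbs f s') s.
      have [/sy[s' a b]|n] := pselect (eqx L (gact d act s (tox x)) (tox x)).
        by exists s'.
      by exists (gone G H W).
    apply: (npi1_le mL mK (f := S)) => [s /hS[]//|s t r hs ht e].
    exists (r \o f); have [_ es] := hS _ hs; have [_ et] := hS _ ht.
    apply: eqs_trans (eqs_sym et) _; apply: eqs_trans (eqs_pbs sf e) _.
    have g := gam_eq d act (r := r \o f) mL yx (fun _ _ => erefl).
    exact: (gmul_eq act mL es g).
  have /choice [S hS] (r : V -> H) : exists r' : W -> H,
      ker d act L (tox x) r -> ker d act K y r' /\ eqr L (r' \o f) r.
    have [/ry[s' a b]|n] := pselect (ker d act L (tox x) r); first by exists s'.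
    by exists (fun=> 1%g).
  apply: (npi2_le (f := S)) => [r /hS[]//|r r' k k' e u p].
  have [_ es] := hS _ k; have [_ et] := hS _ k'.
  by rewrite -es // -et //; apply: e; apply: (sf _ p).
exists F => x fx; have [a b c c'] := hF _ fx; split=> // y fy /asboolP[s e].
have [a' b' _ _] := hF _ fy; apply/asboolP.
apply: (gtrel_trans cm mL (gtrel_eqx cm (eqx_sym b))).
apply: (gtrel_trans cm mL _ (gtrel_eqx cm b')).
by exists (pbs f s); apply: (eqx_pbx sf e).
Qed.

Definition hcard (V : finType) (P : pred (seq V)) : rat :=
  (\sum_(x in creps (flatb P) (relb P)) (npi2 P (tox x))%:R / (npi1 P (tox x))%:R)%R.


Lemma dominated_hcard (V W : finType) (P : pred (seq V)) (Q : pred (seq W)) :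
  mono P -> mono Q -> dominated P Q -> dominated Q P -> hcard P = hcard Q.
Proof.
have half (V' W' : finType) (P' : pred (seq V')) (Q' : pred (seq W')) :
    mono P' -> mono Q' -> dominated P' Q' -> exists f : fcol V' -> fcol W',
    {in creps (flatb P') (relb P') &, injective f} /\
    forall x, x \in creps (flatb P') (relb P') ->
      [/\ f x \in creps (flatb Q') (relb Q'), npi1 P' (tox x) <= npi1 Q' (tox (f x))
        & npi2 P' (tox x) <= npi2 Q' (tox (f x))].
  move=> mP mQ [F hF]; have eP := relb_equiv mP; have eQ := relb_equiv mQ.
  exists (fun x => crep (flatb Q') (relb Q') (F x)); split.
    move=> x y; rewrite !inE => /andP[fx /eqP cx] /andP[fy /eqP cy] e.
    have [fFx inj _ _] := hF x fx; have [fFy _ _ _] := hF y fy.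
    by rewrite -cx -cy; apply: (crep_eq eP) => //; apply: inj => //; apply: (crep_rel eQ).
  move=> x; rewrite inE => /andP[fx _]; have [fF _ a b] := hF x fx.
  have /andP[fc /asboolP r] := crepP eQ fF.
  by have [<- <-] := npi_gtrel_eq mQ r; split=> //; apply: crep_in.
move=> mP mQ /(half _ _ _ _ mP mQ)[f [fi fA]] /(half _ _ _ _ mQ mP)[g [gi gB]].
exact: (mutual_embedding_sum (n1 := fun x => npi1 P (tox x)) (n2 := fun x => npi2 P (tox x))
 (m1 := fun x => npi1 Q (tox x)) (m2 := fun x => npi2 Q (tox x)) fi gi fA gB).
Qed.

(** * Homotopy cardinality from the number of flat colourings *)

Section Total.
Variables (V : finType) (P : pred (seq V)).
Hypotheses (mP : mono P) (P1 : forall v, P [:: v]).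

Definition pairs : pred (V * V) := fun p => P [:: p.1; p.2].
Definition triples : pred (V * V * V) := fun p => P [:: p.1.1; p.1.2; p.2].

Lemma card_eqx (z : col G H V) :
  #|[pred y : fcol V | `[< eqx P z (tox y) >]]| =
  (#|G| ^ #|predC pairs| * #|H| ^ #|predC triples|)%N.
Proof.
rewrite -(card_agree pairs (fun p => z.1 p.1 p.2)).
rewrite -(card_agree triples (fun p => z.2 p.1.1 p.1.2 p.2)) -cardX.
apply: eq_card => -[a b]; rewrite !inE /=; apply/asboolP/andP => -[h1 h2].
  split; apply/forallP => -[u v]; apply/implyP => p; rewrite eq_sym; apply/eqP.
    exact: h1.
  by case: u p => u w p; apply: h2.
split=> [u v p|u v w p]; first by have /forallP/(_ (u, v)) := h1; rewrite /pairs p => /eqP.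
by have /forallP/(_ (u, v, w)) := h2; rewrite /triples p => /eqP.
Qed.

Lemma card_eqs (z : gau G H V) :
  #|[pred y : fgau V | `[< eqs P (tos y) z >]]| = (#|H| ^ #|predC pairs|)%N.
Proof.
rewrite -[RHS]mul1n -(card_agree pairs (fun p => z.2 p.1 p.2)).
rewrite -(card1 [ffun u => z.1 u]) -cardX.
apply: eq_card => -[a b]; rewrite !inE /=; apply/asboolP/andP => -[h1 h2].
  split; first by apply/eqP/ffunP => u; rewrite ffunE; apply: h1.
  apply/forallP => -[u v]; apply/implyP => p; apply/eqP.
  exact: h2.
split=> [u p|u v p] /=; first by rewrite (eqP h1) ffunE.
by have /forallP/(_ (u, v)) := h2; rewrite /pairs p => /eqP.
Qed.

Lemma npi2E x : npi2 P x = #|kerb P x|.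
Proof.
rewrite (card_classes (eqrb_equiv P x) (k := 1%N)) ?muln1 // => r kr.
rewrite -(card1 r); apply: eq_card => r'; rewrite !inE.
apply/andP/eqP => [[_ /asboolP e]|->]; first by apply/ffunP => u; rewrite e.
by split=> //; apply/asboolP.
Qed.

(** Counts the pairs [(r, t)] with [t] equal to [s] times [gam x r] on [P]: each [r] admits the [t]
    with arbitrary values off [P], and the [r] belonging to a given [t] form a coset of pi_2. *)
Lemma card_congb x s : flat d act P x -> stabb P x s ->
  (#|H| ^ #|V| * #|H| ^ #|predC pairs| =
   #|[pred t | stabb P x t && congb P x s t]| * npi2 P x)%N.
Proof.
move=> fx /asboolP ss; rewrite -card_ffun npi2E.
pose R (r : {ffun V -> H}) (t : fgau V) :=
  `[< eqs P (tos t) (gmul act (tos s) (gam d act x r)) >].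
apply: (double_count (pA := predT) (R := R)) => [r _|t /andP[_ /asboolP[r0 e0]]].
  rewrite -(card_eqs (gmul act (tos s) (gam d act x r))); apply: eq_card => t.
  rewrite !inE /=; apply: andb_idl => /asboolP e; apply/andP; split; last first.
    by apply/asboolP; exists r.
  apply/asboolP; apply: eqx_trans (gact_eq d act mP e (eqx_refl _ _)) _.
  apply: eqx_trans (gactM cm _ _ _ _) _; apply: eqx_trans ss.
  by apply: gact_eq => //; apply: (gam_stab cm).
pose f (r : {ffun V -> H}) : {ffun V -> H} := [ffun u => (r0 u)^-1 * r u]%g.
have fb : bijective f.
  exists (fun r : {ffun V -> H} => [ffun u => r0 u * r u]%g) => r; apply/ffunP => u.
    by rewrite !ffunE mulKVg.
  by rewrite !ffunE mulKg.
rewrite -[RHS](on_card_preimset (onW_bij _ fb)); apply: eq_card => r; rewrite !inE /=.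
have fE : eqs P (gam d act x (f r))
    (gmul act (ginv act (gam d act x r0)) (gam d act x r)).
  apply: eqs_sym; apply: eqs_trans (gmul_eq act mP (gamV cm _ _ _) (eqs_refl _ _)) _.
  apply: eqs_trans (gamM cm _ _ _ _) _.
  by apply: gam_eq => // u _; rewrite ffunE.
apply/asboolP/asboolP => [e|/(gam_ker d act) e].
  apply/(gam_ker d act); apply: eqs_trans fE _.
  apply: eqs_trans (gmulVg cm P (gmul act (tos s) (gam d act x r0))).
  apply: eqs_sym; apply: eqs_trans (gmul_eq act mP (eqs_refl _ _) (eqs_sym e0)) _.
  apply: eqs_trans (gmul_eq act mP (eqs_refl _ _) e) _.
  by split=> * /=; rewrite !(cm_actM cm, cm_actV cm, cm_actA cm, cm_actKV cm, invMg, mulgA, mulgKV).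
apply: eqs_trans e0 _; apply: gmul_eq => //.
apply: eqs_sym; apply: eqs_trans (gmulg1 cm _ _).
apply: eqs_sym; apply: eqs_trans (gmul_eq act mP (eqs_refl _ _) (eqs_sym e)) _.
apply: eqs_trans (gmul_eq act mP (eqs_refl _ _) fE) _.
apply: eqs_trans (gmulA cm _ _ _ _) _; apply: eqs_trans (gmul1 cm _ _).
by apply: gmul_eq => //; apply: (gmulV cm).
Qed.

Lemma eqs_tos_inj (s t : fgau V) : eqs xpredT (tos s) (tos t) -> s = t.
Proof.
case: s t => [a b] [a' b'] [/= e1 e2]; congr pair; apply/ffunP => u.
  exact: e1.
by case: u => u v; apply: e2.
Qed.

(** Orbit-stabiliser for gauge transformations, with colourings counted together with their
    arbitrary values off [P]. *)
Lemma card_stabb x : flat d act P (tox x) ->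
  (#|{: fgau V}| * (#|G| ^ #|predC pairs| * #|H| ^ #|predC triples|) =
   #|[pred y | flatb P y && relb P x y]| * #|stabb P (tox x)|)%N.
Proof.
move=> fx; pose R (s : fgau V) (y : fcol V) := `[< eqx P (gact d act (tos s) (tox x)) (tox y) >].
have mT : mono (xpredT : pred (seq V)) by [].
apply: (double_count (pA := predT) (R := R)) => [s _|y /andP[_ /asboolP[t0 e0]]].
  rewrite -(card_eqx (gact d act (tos s) (tox x))); apply: eq_card => y.
  rewrite !inE /=; apply: andb_idl => /asboolP e; apply/andP; split; apply/asboolP.
    by apply: (flat_eqx mP e); apply: (flat_gact cm).
  by exists (tos s).
pose f (s : fgau V) : fgau V := frs (gmul act (ginv act t0) (tos s)).
have fb : bijective f.
  exists (fun s : fgau V => frs (gmul act t0 (tos s))) => s; apply: eqs_tos_inj.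
    apply: eqs_trans (tos_frs _ _) _.
    apply: eqs_trans (gmul_eq act mT (eqs_refl _ _) (tos_frs _ _)) _.
    apply: eqs_trans (gmulA cm _ _ _ _) _; apply: eqs_trans (gmul1 cm _ _).
    by apply: gmul_eq => //; apply: (gmulV cm).
  apply: eqs_trans (tos_frs _ _) _.
  apply: eqs_trans (gmul_eq act mT (eqs_refl _ _) (tos_frs _ _)) _.
  apply: eqs_trans (gmulA cm _ _ _ _) _; apply: eqs_trans (gmul1 cm _ _).
  by apply: gmul_eq => //; apply: (gmulVg cm).
rewrite -[RHS](on_card_preimset (onW_bij _ fb)); apply: eq_card => s; rewrite !inE /=.
have fE : eqx P (gact d act (tos (f s)) (tox x))
                (gact d act (ginv act t0) (gact d act (tos s) (tox x))).
  apply: eqx_trans (gact_eq d act mP (tos_frs _ _) (eqx_refl _ _)) _.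
  exact: (gactM cm).
have iE : eqx P (gact d act (ginv act t0) (tox y)) (tox x).
  apply: eqx_trans (gact1 cm P (tox x)).
  apply: eqx_trans (gact_eq d act mP (gmulVg cm P t0) (eqx_refl P _)).
  apply: eqx_trans (eqx_sym (gactM cm _ _ _ _)).
  exact: (gact_eq d act mP (eqs_refl _ _) (eqx_sym e0)).
apply/asboolP/asboolP => e.
  apply: eqx_trans fE _; apply: eqx_trans iE.
  exact: (gact_eq d act mP (eqs_refl _ _) e).
apply: (eqx_trans _ e0).
apply: eqx_trans (gact_eq d act mP (eqs_refl _ t0) e).
apply: eqx_sym; apply: eqx_trans (gact_eq d act mP (eqs_refl _ t0) fE) _.
apply: eqx_trans (eqx_sym (gactM cm _ _ _ _)) _.
apply: eqx_trans (gact1 cm P _); apply: gact_eq => //.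
exact: (gmulV cm).
Qed.

(** Combining both counts, the weight of pi_2 over pi_1 of a class is its number of flat colourings
    times a factor independent of the class, so the sum over classes becomes a plain count. *)
Lemma hcard_total :
  (hcard P * (#|{: fgau V}| * (#|G| ^ #|predC pairs| * #|H| ^ #|predC triples|))%:R =
   (#|flatb P| * (#|H| ^ #|V| * #|H| ^ #|predC pairs|))%:R)%R.
Proof.
have eP := relb_equiv mP.
rewrite /hcard [in RHS]natrM (card_sum_classes eP) natr_sum !mulr_suml /=.
apply: eq_bigr => x; rewrite inE => /andP[/asboolP fx _].
have n0 : ((npi1 P (tox x))%:R != 0 :> rat)%R.
  by rewrite pnatr_eq0 -lt0n npi1_gt0.
rewrite mulrAC; apply: (canLR (mulfK n0)); rewrite -!natrM; congr (_%:R)%R.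
rewrite (card_stabb fx).
have gt0 : (0 < npi2 P (tox x))%N.
  rewrite npi2E; apply/card_gt0P; exists [ffun => 1%g]; apply/asboolP.
  by split=> *; rewrite !ffunE ?(cm_d1 cm) ?(cm_act_1 cm).
have s0 : stabb P (tox x) (frs (gone G H V)).
  apply/asboolP; apply: eqx_trans (gact1 cm P _); apply: gact_eq => //.
  exact: tos_frs.
(* By [card_congb] all cosets in the stabiliser have this same size, after cancelling the positive
   order of pi_2. *)
pose k := #|[pred t | stabb P (tox x) t && congb P (tox x) (frs (gone G H V)) t]|.
rewrite (@card_classes _ _ _ (congb_equiv mP (tox x)) k); last first.
  move=> s ss; apply/eqP; rewrite -(eqn_pmul2r gt0); apply/eqP.
  by rewrite -!card_congb.
rewrite (card_congb fx s0) -/k /npi1.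
ring.
Qed.

End Total.

End Counting.

(** * Ordered colourings *)

Section OrderedAlgebra.
Local Open Scope group_scope.
Variables (G H : finGroupType) (d : H -> G) (act : G -> H -> H).
Hypothesis cm : crossed_module d act.
Variables (V : finType) (rank : V -> nat).
Hypothesis ri : injective rank.
Implicit Types (P : pred (seq V)) (x y : col G H V).

Definition incr_eqx P x y :=
  [/\ forall u v, rank u < rank v -> P [:: u; v] -> x.1 u v = y.1 u v,
      forall u v w, rank u < rank v -> rank v < rank w -> P [:: u; v; w] ->
        x.2 u v w = y.2 u v w
    & forall u v, rank u <= rank v -> P [:: u; v] -> x.2 u v u = y.2 u v u].

Ltac sub mP := (apply: (mono_sub mP _ (s := _)); last by eassumption);
  rewrite /= !inE !eqxx ?orbT.

(** Flatness recovers everything else: [[:: v; v; v]] gives the loop colours, [[:: v; u; v]] the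
    reversed edges, and tetrahedra with repeated vertices the degenerate triangles and the
    transpositions of a triangle. *)
Lemma incr_eqx_eqx P x y : mono P -> flat d act P x -> flat d act P y ->
  incr_eqx P x y -> eqx P x y.
Proof.
move=> mP [fx1 fx2] [fy1 fy2] [e1 e2 e3].
have P1 u v : P [:: u; v] -> P [:: u; u].
  by move=> p; sub mP.
have P2 u v : P [:: u; v] -> P [:: v; u].
  by move=> p; sub mP.
have d1 v : P [:: v; v] -> x.1 v v = y.1 v v.
  move=> p; have q : P [:: v; v; v] by sub mP.
  have := fx1 _ _ _ q; have := fy1 _ _ _ q; rewrite -(e3 v v) //.
  move=> /(canRL (mulgK _)); rewrite mulgV => hy.
  move=> /(canRL (mulgK _)); rewrite mulgV => hx.
  by apply: (mulgI (d (x.2 v v v))); rewrite hx hy.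
have E1 u v : P [:: u; v] -> x.1 u v = y.1 u v.
  move=> p; case: (ltngtP (rank u) (rank v)) => [lt|lt|/ri e]; first exact: e1.
    have q : P [:: v; u; v] by sub mP.
    have := fx1 _ _ _ q; have := fy1 _ _ _ q.
    rewrite -(e3 v u) ?(ltnW lt) -?(e1 v u) -?d1 //; try by sub mP.
    move=> <- /mulIg /mulgI //.
  by rewrite -e in p *; apply: d1.
have vvw v w : P [:: v; w] -> x.2 v v w = y.2 v v w.
  move=> p; have q : P [:: v; v; v; w] by sub mP.
  have := fx2 _ _ _ _ q; have := fy2 _ _ _ _ q.
  rewrite -(e3 v v) // ?(P1 _ _ p) // -E1 // => /mulgI <- /mulgI <- //.
have vww v w : P [:: v; w] -> x.2 v w w = y.2 v w w.
  move=> p; have q : P [:: v; w; w; w] by sub mP.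
  have pw : P [:: w; w] by sub mP.
  have := fx2 _ _ _ _ q; have := fy2 _ _ _ _ q.
  rewrite -(e3 w w) // -E1 // => /mulgI hy /mulgI hx.
  by rewrite -(cm_actKV cm (x.1 w w) (x.2 v w w)) hx -hy (cm_actKV cm).
have vwv v w : P [:: v; w] -> x.2 v w v = y.2 v w v.
  move=> p; case: (leqP (rank v) (rank w)) => [le|lt]; first exact: e3.
  have q : P [:: w; v; w; v] by sub mP.
  have := fx2 _ _ _ _ q; have := fy2 _ _ _ _ q.
  rewrite -(e3 w v) ?(ltnW lt) -?vvw -?vww -?E1 //; try by sub mP.
  by move=> -> /mulgI.
(* The tetrahedron [(u, v, u, w)] contains both [(u, v, w)] and [(v, u, w)], its other faces being
   degenerate; [(u, w, v, w)] does the same for the last two vertices. *)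
have s12 u v w : P [:: u; v; w] -> x.2 u v w = y.2 u v w -> x.2 v u w = y.2 v u w.
  move=> p e; have q : P [:: u; v; u; w] by sub mP.
  have := fx2 _ _ _ _ q; have := fy2 _ _ _ _ q.
  rewrite -vvw -?vwv -?e -?E1 //; try by sub mP.
  by move=> -> /mulgI.
have s23 u v w : P [:: u; v; w] -> x.2 u v w = y.2 u v w -> x.2 u w v = y.2 u w v.
  move=> p e; have q : P [:: u; w; v; w] by sub mP.
  have := fx2 _ _ _ _ q; have := fy2 _ _ _ _ q.
  rewrite -vww -?vwv -?e -?E1 //; try by sub mP.
  move=> <- /mulgI h.
  by rewrite -(cm_actKV cm (x.1 v w) (x.2 u w v)) h (cm_actKV cm).
have b u v w : P [:: u; v; w] -> rank u <= rank v -> rank v <= rank w ->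
    x.2 u v w = y.2 u v w.
  rewrite leq_eqVlt => p /orP[/eqP/ri <-|uv]; first by move=> _; apply: vvw; sub mP.
  rewrite leq_eqVlt => /orP[/eqP/ri <-|vw]; last exact: e2.
  by apply: vww; sub mP.
split=> // u v w p.
have [uv|vu] := leqP (rank u) (rank v); [have [vw|wv] := leqP (rank v) (rank w)|have [uw|wu] := leqP (rank u) (rank w)].
- exact: b.
- have [uw|wu] := leqP (rank u) (rank w).
    by apply: (s23 _ _ _); [sub mP|apply: b => //; [sub mP|exact: ltnW]].
  apply: (s23 _ _ _); first by sub mP.
  by apply: (s12 _ _ _); [sub mP|apply: b => //; [sub mP|exact: ltnW]].
- by apply: (s12 _ _ _); [sub mP|apply: b => //; [sub mP|exact: ltnW]].
have [vw|wv] := leqP (rank v) (rank w).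
  apply: (s12 _ _ _); first by sub mP.
  by apply: (s23 _ _ _); [sub mP|apply: b => //; [sub mP|exact: ltnW]].
apply: (s12 _ _ _); first by sub mP.
apply: (s23 _ _ _); first by sub mP.
by apply: (s12 _ _ _); [sub mP|apply: b; [sub mP|exact: ltnW|exact: ltnW]].
Qed.

Definition incr_flat P x :=
  (forall j k l, rank j < rank k -> rank k < rank l -> P [:: j; k; l] ->
     d (x.2 j k l) * x.1 k l * x.1 j k = x.1 j l) /\
  (forall j k l m, rank j < rank k -> rank k < rank l -> rank l < rank m ->
     P [:: j; k; l; m] ->
     x.2 j l m * act (x.1 l m) (x.2 j k l) = x.2 j k m * x.2 k l m).

(** On a single simplex the extension can be sought as a gauge transform of the trivial colouring,
    which is flat whatever the transformation. *)
Lemma incr_extend_simplex P x (b : V -> V -> H) (S : seq V) : mono P ->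
  incr_flat P x -> P S -> S != [::] -> exists y, flat d act (simplex_on S) y /\
   [/\ forall u v, rank u < rank v -> simplex_on S [:: u; v] -> y.1 u v = x.1 u v,
      forall u v w, rank u < rank v -> rank v < rank w -> simplex_on S [:: u; v; w] ->
        y.2 u v w = x.2 u v w
    & forall u v, rank u <= rank v -> simplex_on S [:: u; v] -> y.2 u v u = b u v].
Proof.
move=> mP [f1 f2] pS S0.
have [m mS mn] : exists2 m, m \in S & forall v, v \in S -> rank m <= rank v.
  case: S S0 {pS} => // a S _.
  have a0 : a \in a :: S by rewrite inE eqxx.
  by case: (arg_minnP (P := fun v => v \in a :: S) rank a0) => m mS mn; exists m.
(* The cone from the least vertex [m] uses only increasing tuples of [x], with 1 in the degenerate
   positions. *)
pose p v := if v == m then 1 else x.1 m v.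
pose q v w := if v == m then 1 else (x.2 m v w)^-1.
(* The values for [rank w <= rank v] do not affect increasing tuples and are solved from the
   requirement that the colour of [(w, v, w)] be [b w v]. *)
pose t : gau G H V := (p, fun v w =>
  if rank v < rank w then q v w else if v == w then (b v v)^-1
  else (b w v)^-1 * (b w w)^-1 * (act (p w * (p v)^-1) (q w v))^-1).
exists (gact d act t (triv G H V)); split.
  by apply: (flat_gact cm) (@mono_simplex_on _ S) (flat_triv cm _).
have lt v : v \in S -> v != m -> rank m < rank v.
  move=> vS vm; rewrite ltn_neqAle mn // andbT; apply: contra vm => /eqP/ri -> //.
have PS s : all (mem S) s -> P (m :: s).
  move=> /allP sS; apply: mP pS => v; rewrite inE => /orP[/eqP->//|/sS].
  by rewrite inE.
have g1 u v : rank u < rank v -> simplex_on S [:: u; v] ->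
    (gact d act t (triv G H V)).1 u v = x.1 u v.
  move=> uv i; rewrite /= uv /q /p.
  have /and3P[uS vS _] := i; rewrite /= in uS vS.
  have vm : v != m.
    by apply/negP => /eqP e; have := mn _ uS; rewrite leqNgt -e uv.
  rewrite (negPf vm); case: ifPn => [/eqP->|um].
    by rewrite (cm_d1 cm) invg1 mul1g !mulg1.
  rewrite -(f1 m u v (lt _ uS um) uv (PS _ i)) (cm_dV cm) mulg1 -!mulgA mulKg mulgA.
  by rewrite mulgK.
split=> //.
  move=> u v w uv vw i; have /and4P[uS vS wS _] := i; rewrite /= in uS vS wS.
  have uw := ltn_trans uv vw.
  have ivw : simplex_on S [:: v; w] by rewrite /simplex_on /= vS wS.
  have vm : v != m.
    by apply/negP => /eqP e; have := mn _ uS; rewrite leqNgt -e uv.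
  have := g1 v w vw ivw; rewrite /= vw => ->; rewrite uw uv (cm_act_1 cm) mulg1 /q (negPf vm).
  rewrite invgK; case: ifPn => [/eqP->|um].
    by rewrite (cm_act_1 cm) invg1 mul1g mulg1.
  rewrite (cm_actV cm) invgK -mulgA.
  by rewrite (f2 m u v w (lt _ uS um) uv vw (PS _ i)) mulKg.
move=> u v; rewrite leq_eqVlt => /orP[/eqP/ri <-|uv] i /=.
  rewrite ltnn eqxx (cm_act_1 cm) !mulg1 mulgV mul1g mulgK (cm_peif cm) mulgK.
  by rewrite invgK.
have nvu : (rank v < rank u) = false by apply/negbTE; rewrite -leqNgt ltnW.
have vu : (v == u) = false by apply/negbTE; apply: contraTneq uv => ->; rewrite ltnn.
rewrite ltnn eqxx uv nvu vu (cm_act_1 cm) !mulg1.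
set z := act (p u * (p v)^-1) (q u v).
rewrite -[X in act X _]mulgA (cm_actA cm) -/z (cm_peif cm).
by rewrite !(invMg, invgK, mulgA, mulgK, mulgKV, mulVg, mul1g, mulgV).
Qed.

(** Since [b] also prescribes the colours of [(u, v, u)], the extension over a simplex is unique by
    [incr_eqx_eqx]. The extensions over different simplices therefore agree on common faces, and
    each tuple may be read in its own. *)
Lemma incr_extend P x (b : V -> V -> H) : mono P -> incr_flat P x ->
  exists y, flat d act P y /\
   [/\ forall u v, rank u < rank v -> P [:: u; v] -> y.1 u v = x.1 u v,
      forall u v w, rank u < rank v -> rank v < rank w -> P [:: u; v; w] ->
        y.2 u v w = x.2 u v w
    & forall u v, rank u <= rank v -> P [:: u; v] -> y.2 u v u = b u v].
Proof.
move=> mP fx.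
have /choice [Y hY] (S : seq V) : exists y, P S -> S != [::] ->
   flat d act (simplex_on S) y /\
   [/\ forall u v, rank u < rank v -> simplex_on S [:: u; v] -> y.1 u v = x.1 u v,
      forall u v w, rank u < rank v -> rank v < rank w -> simplex_on S [:: u; v; w] ->
        y.2 u v w = x.2 u v w
    & forall u v, rank u <= rank v -> simplex_on S [:: u; v] -> y.2 u v u = b u v].
  have [[pS S0]|n] := pselect (P S /\ S != [::]).
    by have [y hy] := incr_extend_simplex b mP fx pS S0; exists y.
  by exists x => pS S0; case: n.
pose y : col G H V := (fun u v => (Y [:: u; v]).1 u v, fun u v w => (Y [:: u; v; w]).2 u v w).
have loc S : P S -> S != [::] -> eqx (simplex_on S) (Y S) y.
  move=> pS S0; have [fS [a1 a2 a3]] := hY S pS S0.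
  have key s : simplex_on S s -> s != [::] -> eqx (simplex_on s) (Y S) (Y s).
    move=> sS s0; have ps : P s by apply: (sub_simplex_on mP pS).
    have [fs [b1 b2 b3]] := hY s ps s0.
    have sub : subpred (simplex_on s) (simplex_on S).
      by apply: sub_simplex_on sS; apply: mono_simplex_on.
    apply: incr_eqx_eqx => //; first exact: mono_simplex_on.
      exact: flat_sub fS.
    split=> [u v uv i|u v w uv vw i|u v uv i].
    - by rewrite a1 ?b1 //; apply: sub.
    - by rewrite a2 ?b2 //; apply: sub.
    by rewrite a3 ?b3 //; apply: sub.
  split=> [u v i|u v w i]; first by apply: (key _ i _).1; rewrite // /simplex_on; apply/allP.
  by apply: (key _ i _).2; rewrite // /simplex_on; apply/allP.
have refl (s : seq V) : simplex_on s s by apply/allP.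
exists y; split.
  apply: flat_loc => -[|a S] pS; first by split.
  have [fS _] := hY _ pS isT.
  exact: (flat_eqx (@mono_simplex_on _ _) (loc _ pS isT) fS).
split=> [u v uv p|u v w uv vw p|u v uv p].
- by have [_ [h _ _]] := hY _ p isT; apply: (h _ _ uv); apply: refl.
- by have [_ [_ h _]] := hY _ p isT; apply: (h _ _ _ uv vw); apply: refl.
have q : P [:: u; v; u] by sub mP.
have [_ [_ _ h]] := hY _ q isT; apply: (h _ _ uv).
by rewrite /simplex_on /= !inE !eqxx orTb orbT.
Qed.

End OrderedAlgebra.

(** The empty tuple is added by hand: [K] has no empty simplex, but [mono] requires it. *)
Definition cplx (V : finType) (K : {set {set V}}) : pred (seq V) :=
  fun s => (s == [::]) || ([set x in s]%SET \in K).

Lemma prod_delta (X : finGroupType) (T : finType) (A : {set T}) (f : T -> X) :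
  (\prod_(t in A) deltaQ (f t) =
   if [forall t in A, f t == 1%g] then (#|X| ^ #|A|)%:R else 0)%R.
Proof.
case: ifPn => [/forall_inP h|/forall_inPn[t tA n]].
  rewrite (eq_bigr (fun=> #|X|%:R)%R); last by move=> t /h e; rewrite /deltaQ e.
  by rewrite prodr_const natrX.
by rewrite (bigD1 t) //= /deltaQ (negPf n) mul0r.
Qed.

(** * The state sum as a homotopy cardinality *)

Section StateSum.
Variables (G H : finGroupType) (d : H -> G) (act : G -> H -> H).
Hypothesis cm : crossed_module d act.
Variables (V : finType) (K : {set {set V}}) (rank : V -> nat).
Hypotheses (sc : simplicial_complex K) (ri : injective rank).
Local Notation P := (cplx K).

Lemma mono_cplx : mono P.
Proof.
move=> s [|a t] sub //; rewrite /cplx /= => h; case: sc => _ [dc _].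
have aS : a \in s by apply: sub; rewrite inE eqxx.
case/orP: h => [/eqP e|sK]; first by rewrite e in aS.
apply: dc sK _ _; first by apply/fintype.subsetP => v; rewrite !inE => vt; apply: sub; rewrite inE.
by apply/finset.set0Pn; exists a; rewrite !inE eqxx.
Qed.

Lemma set_seq1 (u : V) : ([set x in [:: u]] = [set u])%SET.
Proof. by apply/setP => i; rewrite !inE. Qed.
Lemma set_seq2 (u v : V) : ([set x in [:: u; v]] = [set u; v])%SET.
Proof. by apply/setP => i; rewrite !inE. Qed.
Lemma set_seq3 (u v w : V) : ([set x in [:: u; v; w]] = [set u; v; w])%SET.
Proof. by apply/setP => i; rewrite !inE orbA. Qed.

Lemma cplx1 v : P [:: v].
Proof. by case: sc => _ [_ h]; rewrite /cplx set_seq1 h. Qed.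

Lemma cplx3 u v w : P [:: u; v; w] = ([set u; v; w]%SET \in K).
Proof. by rewrite /cplx set_seq3. Qed.

Local Notation ltr := (fun a b => rank a < rank b).
Local Notation ord := (ordered_vertices rank).

Lemma ord_mem s v : (v \in ord s) = (v \in s).
Proof. by rewrite mem_sort mem_enum. Qed.
Lemma ord_sorted s : sorted ltr (ord s).
Proof.
rewrite (_ : sorted ltr _ = sorted ltn (map rank (ord s))); last by rewrite sorted_map.
rewrite ltn_sorted_uniq_leq map_inj_uniq // sort_uniq enum_uniq /= sorted_map.
by apply: sort_sorted => a b; apply: leq_total.
Qed.
Lemma set_ord s : [set x in ord s]%SET = s.
Proof. by apply/setP => v; rewrite inE ord_mem. Qed.
Lemma size_ord s : size (ord s) = #|s|.
Proof. by rewrite size_sort cardE. Qed.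
Lemma ord_set l : sorted ltr l -> ord [set x in l]%SET = l.
Proof.
have tr : transitive ltr by move=> b a c; apply: ltn_trans.
have ir : irreflexive ltr by move=> a; apply: ltnn.
move=> sl; apply: (irr_sorted_eq tr ir) => //; first exact: ord_sorted.
by move=> v; rewrite ord_mem inE.
Qed.

Lemma card_set_seq l : sorted ltr l -> #|[set x in l]%SET| = size l.
Proof. by move=> /ord_set {2}<-; rewrite size_ord. Qed.

Definition ordcol (p : {ffun {set V} -> G} * {ffun {set V} -> H}) : col G H V :=
  (fun u v => p.1 [set u; v]%SET, fun u v w => p.2 [set u; v; w]%SET).

Definition ordflat (p : {ffun {set V} -> G} * {ffun {set V} -> H}) : bool :=
  [&& edge_colouring K p.1, face_colouring K p.2,
      [forall t in simplices K 2, face_holonomy d rank p.1 p.2 t == 1%g] &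
      [forall t in simplices K 3, tet_holonomy act rank p.1 p.2 t == 1%g]].

Lemma ordflat_incr p : ordflat p -> incr_flat d act rank P (ordcol p).
Proof.
move=> /and4P[_ _ /forall_inP h2 /forall_inP h3].
split=> [j k l jk kl pj|j k l m jk kl lm pj] /=.
  have srt : sorted ltr [:: j; k; l] by rewrite /= jk kl.
  have /h2 : [set x in [:: j; k; l]]%SET \in simplices K 2.
    by rewrite inE card_set_seq // set_seq3 -cplx3 pj.
  rewrite /face_holonomy ord_set // set_seq3 => /eqP /(canRL (mulgKV _)).
  by rewrite mul1g.
have srt : sorted ltr [:: j; k; l; m] by rewrite /= jk kl lm.
have /h3 : [set x in [:: j; k; l; m]]%SET \in simplices K 3.
  by rewrite inE card_set_seq // eqxx andbT.
rewrite /tet_holonomy ord_set // => /eqP /(canRL (mulgKV _)).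
by rewrite mul1g => /(canRL (mulgKV _)).
Qed.

Lemma incr_ordflat p : edge_colouring K p.1 -> face_colouring K p.2 ->
  incr_flat d act rank P (ordcol p) -> ordflat p.
Proof.
move=> e1 e2 [h2 h3]; apply/and4P; split=> //; apply/forall_inP => t.
  rewrite inE => /andP[tK /eqP ct]; have := ord_sorted t; have := set_ord t.
  have := size_ord t; rewrite ct /face_holonomy.
  case: (ord t) => [|j [|k [|l []]]] //= _ e /and3P[jk kl _].
  have pj : P [:: j; k; l] by rewrite /cplx e tK.
  have /= := h2 _ _ _ jk kl pj; rewrite -set_seq3 e => ->.
  by rewrite mulgV.
rewrite inE => /andP[tK /eqP ct]; have := ord_sorted t; have := set_ord t.
have := size_ord t; rewrite ct /tet_holonomy.
case: (ord t) => [|j [|k [|l [|m []]]]] //= _ e /and4P[jk kl lm _].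
have pj : P [:: j; k; l; m] by rewrite /cplx e tK.
have /= -> := h3 _ _ _ _ jk kl lm pj.
by rewrite mulgK mulgV.
Qed.

(* Values off the complex are unconstrained; on it, flatness determines the colours of all
   tuples from the increasing ones and the [h_uvu] with [u <= v], which are arbitrary. *)
Definition free_triples : pred (V * V * V) := fun p =>
  ~~ triples P p || (p.1.1 == p.2) && (rank p.1.1 <= rank p.1.2).

Definition ordered_data := (({ffun {set V} -> G} * {ffun {set V} -> H}) *
  ({ffun V * V -> G} * {ffun V * V * V -> H}))%type.

(** A bijection from flat colourings onto [ordered_target]: an ordered colouring together with all
    values that flatness leaves free, with 1 in the remaining places. *)
Definition ordered_part (x : fcol G H V) : ordered_data :=
  ((([ffun s : {set V} => if s \in simplices K 1 then
        match ord s with [:: j; k] => x.1 (j, k) | _ => 1%g end else 1%g] : {ffun {set V} -> G}),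
    ([ffun s : {set V} => if s \in simplices K 2 then
        match ord s with [:: j; k; l] => x.2 (j, k, l) | _ => 1%g end else 1%g] : {ffun {set V} -> H})),
   (([ffun p => if pairs P p then 1%g else x.1 p] : {ffun V * V -> G}),
    ([ffun p => if free_triples p then x.2 p else 1%g] : {ffun V * V * V -> H}))).

Lemma ordered_part_incr x : [/\ forall u v, rank u < rank v -> P [:: u; v] ->
      (ordcol (ordered_part x).1).1 u v = x.1 (u, v)
  & forall u v w, rank u < rank v -> rank v < rank w -> P [:: u; v; w] ->
     (ordcol (ordered_part x).1).2 u v w = x.2 (u, v, w)].
Proof.
split=> [u v uv p|u v w uv vw p] /=.
  have srt : sorted ltr [:: u; v] by rewrite /= uv.
  rewrite ffunE -set_seq2 inE card_set_seq // ord_set //.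
  by move: p; rewrite /cplx /= => ->; rewrite eqxx.
have srt : sorted ltr [:: u; v; w] by rewrite /= uv vw.
rewrite ffunE -set_seq3 inE card_set_seq // ord_set //.
by move: p; rewrite /cplx /= => ->; rewrite eqxx.
Qed.

Ltac sub mP := (apply: (mono_sub mP _ (s := _)); last by eassumption);
  rewrite /= !inE !eqxx ?orbT.

Lemma ordered_part_inj : {in flatb d act P &, injective ordered_part}.
Proof.
move=> x y /asboolP fx /asboolP fy e.
have [x1 x2] := ordered_part_incr x; have [y1 y2] := ordered_part_incr y.
have b p : free_triples p -> x.2 p = y.2 p.
  move=> bp; have := congr1 (fun z : ordered_data => z.2.2 p) e; rewrite /= !ffunE bp //.
have [e1 e2] : eqx P (tox x) (tox y).
  apply: (incr_eqx_eqx cm ri mono_cplx fx fy); split=> [u v uv p|u v w uv vw p|u v uv p] /=.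
  - by rewrite -x1 // -y1 // e.
  - by rewrite -x2 // -y2 // e.
  by apply: b; rewrite /free_triples /= eqxx uv orbT.
rewrite (surjective_pairing x) (surjective_pairing y); congr pair; apply/ffunP.
  move=> [u v]; case p : (P [:: u; v]); first exact: e1.
  by have := congr1 (fun z : ordered_data => z.2.1 (u, v)) e; rewrite /= !ffunE /pairs /= p.
move=> [[u v] w]; case p : (P [:: u; v; w]); first exact: e2.
by apply: b; rewrite /free_triples /triples /= p.
Qed.

Definition ordered_target : pred ordered_data := fun z =>
  ordflat z.1 && ([forall p, pairs P p ==> (z.2.1 p == 1%g :> G)] &&
                  [forall p, predC free_triples p ==> (z.2.2 p == 1%g :> H)]).

Lemma ordered_part_target x : flatb d act P x -> ordered_target (ordered_part x).
Proof.
move=> /asboolP [f1 f2]; apply/andP; split; last first.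
  apply/andP; split; apply/forallP => p; apply/implyP; rewrite /= ffunE.
    by move=> ->.
  by move=> /negPf ->.
have [x1 x2] := ordered_part_incr x; apply: incr_ordflat.
- by apply/forallP => s; apply/implyP => /negPf n; rewrite ffunE n.
- by apply/forallP => s; apply/implyP => /negPf n; rewrite ffunE n.
have mP := mono_cplx.
split=> [j k l jk kl p|j k l m jk kl lm p].
  have jl := ltn_trans jk kl.
  rewrite !x1 ?x2 //; try by sub mP.
  exact: f1.
have jl := ltn_trans jk kl; have km := ltn_trans kl lm.
rewrite !x2 ?x1 //; try by sub mP.
exact: f2.
Qed.

Lemma ordered_part_onto z : ordered_target z -> exists2 x, flatb d act P x & ordered_part x = z.
Proof.
case: z => [[g h] [a b]] /andP[/= fo /andP[/forallP ha /forallP hb]].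
have mP := mono_cplx.
have [y [fy [y1 y2 y3]]] := incr_extend cm ri (fun u v => b (u, v, u)) mP (ordflat_incr fo).
pose x : fcol G H V := ([ffun p => if pairs P p then y.1 p.1 p.2 else a p],
  [ffun p => if triples P p then y.2 p.1.1 p.1.2 p.2 else b p]).
have xy : eqx P y (tox x).
  by split=> [u v|u v w] p; rewrite /= ffunE /pairs /triples /= p.
have /and4P[/forallP eg /forallP eh _ _] := fo.
exists x; first by apply/asboolP; apply: (flat_eqx mP xy fy).
congr (_, _, (_, _)); apply/ffunP => p; rewrite ffunE.
- case: ifPn => [|n]; last by have /implyP/(_ n)/eqP := eg p.
  rewrite inE => /andP[tK /eqP ct]; have := ord_sorted p; have := set_ord p.
  have := size_ord p; rewrite ct; case: (ord p) => [|j [|k []]] //= _ e /andP[jk _].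
  have pj : P [:: j; k] by rewrite /cplx e tK.
  by rewrite ffunE /pairs /= pj y1 //= -set_seq2 e.
- case: ifPn => [|n]; last by have /implyP/(_ n)/eqP := eh p.
  rewrite inE => /andP[tK /eqP ct]; have := ord_sorted p; have := set_ord p.
  have := size_ord p; rewrite ct; case: (ord p) => [|j [|k [|l []]]] //= _ e /and3P[jk kl _].
  have pj : P [:: j; k; l] by rewrite /cplx e tK.
  by rewrite ffunE /triples /= pj y2 //= -set_seq3 e.
- by case: ifPn => [n|/negPf n]; [have /implyP/(_ n)/eqP := ha p|rewrite ffunE n].
case: ifPn => [|n]; last by have /implyP/(_ n)/eqP := hb p.
rewrite ffunE /free_triples; case: ifPn => //= tp /andP[/eqP e le].
case: p e le tp => [[u v] w] /= <- le tp; apply: y3 => //.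
by rewrite /triples /= in tp; sub mP.
Qed.

Lemma card_flat : #|flatb d act P| =
  (#|ordflat| * (#|G| ^ #|predC (pairs P)| * #|H| ^ #|free_triples|))%N.
Proof.
rewrite -(card_in_imset ordered_part_inj).
transitivity #|ordered_target|.
  apply: eq_card => z; apply/imsetP/idP => [[x fx ->]|/ordered_part_onto[x fx <-]].
    exact: ordered_part_target.
  by exists x.
have <- : #|predC (predC free_triples)| = #|free_triples|.
  by apply: eq_card => p; rewrite !inE negbK.
rewrite -(card_agree (pairs P) (fun=> 1%g : G)).
rewrite -(card_agree (predC free_triples) (fun=> 1%g : H)) -!cardX.
by apply: eq_card => -[p [a b]].
Qed.


Definition incr_pairs : pred (V * V) := fun p => pairs P p && (rank p.1 < rank p.2).
Definition weak_incr_pairs : pred (V * V) := fun p => pairs P p && (rank p.1 <= rank p.2).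

Lemma card_simplices0 : #|simplices K 0| = #|V|.
Proof.
rewrite -(card_imset _ (@finset.set1_inj V)); apply: eq_card => s.
apply/idP/imsetP => [|[v _ ->]]; rewrite inE; last first.
  by rewrite cards1 eqxx andbT; case: sc => _ [_].
by case/andP=> _ /cards1P[v ->]; exists v.
Qed.

Lemma card_incr_pairs : #|incr_pairs| = #|simplices K 1|.
Proof.
have inj : {in incr_pairs &, injective (fun p : V * V => [set x in [:: p.1; p.2]]%SET)}.
  move=> [u v] [u' v'] /andP[_ /= uv] /andP[_ /= uv'] /(congr1 ord).
  by rewrite !ord_set /= ?uv ?uv' // => -[-> ->].
rewrite -(card_in_imset inj); apply: eq_card => s.
apply/imsetP/idP => [[[u v] /andP[/= p uv] ->]|].
  by rewrite inE card_set_seq /= ?uv // eqxx andbT; move: p; rewrite /pairs /cplx.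
rewrite inE => /andP[sK /eqP cs]; have := ord_sorted s; have := set_ord s.
have := size_ord s; rewrite cs; case: (ord s) => [|u [|v []]] //= _ e /andP[uv _].
by exists (u, v); rewrite // unfold_in /incr_pairs /pairs /= uv /cplx e sK.
Qed.

Lemma card_weak_incr_pairs : #|weak_incr_pairs| = (#|V| + #|simplices K 1|)%N.
Proof.
rewrite -card_incr_pairs -(cardID [pred p : V * V | p.1 == p.2]); congr addn.
  have inj : injective (fun v : V => (v, v)) by move=> u v [].
  rewrite -(card_codom inj); apply: eq_card => -[u v]; rewrite !inE /=.
  apply/andP/codomP => [[_ /eqP /= ->]|[w [-> ->]]]; first by exists v.
  split; last exact: eqxx.
  rewrite unfold_in /weak_incr_pairs /= leqnn andbT /pairs /=.
  by have := cplx1 w; apply: mono_cplx => i; rewrite !inE orbb.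
apply: eq_card => -[u v]; rewrite !inE unfold_in /weak_incr_pairs [RHS]unfold_in /incr_pairs /=.
rewrite ltn_neqAle (inj_eq ri); by case: (u == v); rewrite /= ?andbF.
Qed.

Lemma card_pairs : #|pairs P| = (#|V| + 2 * #|simplices K 1|)%N.
Proof.
rewrite -(cardID [pred p : V * V | rank p.1 <= rank p.2]).
rewrite mulSn mul1n addnA -card_weak_incr_pairs; congr addn.
have inj : injective (fun p : V * V => (p.2, p.1)) by move=> [a b] [a' b'] [-> ->].
rewrite -card_incr_pairs -(fintype.card_image inj).
apply: eq_card => -[u v]; apply/fintype.imageP/idP => [[[a b]]|].
  rewrite !inE /= -ltnNge => /andP[ba p] [-> ->]; rewrite unfold_in /incr_pairs /= ba andbT.
  by move: p; rewrite unfold_in /pairs /=; apply: mono_cplx => i; rewrite !inE orbC.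
rewrite unfold_in /incr_pairs /= => /andP[p uv]; exists (v, u) => //.
rewrite !inE /= -ltnNge uv /= unfold_in /pairs /=.
by move: p; rewrite /pairs /=; apply: mono_cplx => i; rewrite !inE orbC.
Qed.

Lemma card_free_triples :
  #|free_triples| = (#|predC (triples P)| + (#|V| + #|simplices K 1|))%N.
Proof.
rewrite -card_weak_incr_pairs -(cardID (predC (triples P))); congr addn.
  apply: eq_card => p; rewrite !inE; apply: andb_idl => n.
  by apply/orP; left; exact: n.
have inj : injective (fun p : V * V => (p.1, p.2, p.1)) by move=> [a b] [a' b'] [-> ->].
rewrite -[RHS](fintype.card_image inj); apply: eq_card => -[[u v] w]; apply/idP/fintype.imageP.
  rewrite !inE => /andP[/negPn t /orP[/negP//|/andP[/= /eqP <- le]]].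
  exists (u, v) => //; apply/andP; split=> //.
  by apply: mono_cplx t => i; rewrite !inE => /orP[] ->; rewrite ?orbT.
case=> -[a b] /andP[p le] [-> -> ->].
have t : (a, b, a) \in triples P.
  by apply: mono_cplx p => i; rewrite !inE => /or3P[] ->; rewrite ?orbT.
rewrite !inE; apply/andP; split; first by apply/negPn; exact: t.
by apply/orP; right; rewrite /= eqxx.
Qed.

Lemma state_sum_ordflat :
  (\sum_(g : {ffun {set V} -> G} | edge_colouring K g)
      \sum_(h : {ffun {set V} -> H} | face_colouring K h)
        ((\prod_(t in simplices K 2) deltaQ (face_holonomy d rank g h t))
         * (\prod_(t in simplices K 3) deltaQ (tet_holonomy act rank g h t))) =
   #|ordflat|%:R * ((#|G| ^ #|simplices K 2|)%:R * (#|H| ^ #|simplices K 3|)%:R))%R.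
Proof.
rewrite pair_big /= mulr_natl -sumr_const big_mkcond [RHS]big_mkcond /=.
apply: eq_bigr => -[g h] _; rewrite !prod_delta unfold_in /ordflat /=.
case: (edge_colouring K g) => //=; case: (face_colouring K h) => //=.
by case: ifP => _; case: ifP => _; rewrite ?mulr0 ?mul0r.
Qed.

Lemma Zinv_hcard : Zinv d act K rank = hcard d act P.
Proof.
have mP := mono_cplx; have := hcard_total cm mP cplx1.
rewrite card_flat card_free_triples card_prod !card_ffun card_prod.
(* Splits the exponent of the edge part of the gauge transformations into tuples off the complex,
   degenerate pairs, and each edge in its two orders. *)
have Vp : (#|V| * #|V| = #|predC (pairs P)| + (#|V| + (#|simplices K 1| + #|simplices K 1|)))%N.
  by rewrite addnn -mul2n -card_pairs -card_prod -(cardC (pairs P)) addnC.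
rewrite Vp /Zinv state_sum_ordflat /nK card_simplices0 !expnD !natrM !natrX.
set g := (#|G|%:R : rat)%R; set h := (#|H|%:R : rat)%R.
have g0 : (g != 0)%R by rewrite pnatr_eq0 -lt0n; apply/card_gt0P; exists 1%g.
have h0 : (h != 0)%R by rewrite pnatr_eq0 -lt0n; apply/card_gt0P; exists 1%g.
have gn n : (g ^+ n != 0)%R by rewrite expf_neq0.
have hn n : (h ^+ n != 0)%R by rewrite expf_neq0.
rewrite !expfzDr // -!exprnN -!exprnP.
set a := (g ^+ #|V|)%R; set a1 := (g ^+ #|simplices K 1|)%R.
set a2 := (g ^+ #|simplices K 2|)%R; set c := (g ^+ _)%R.
set b := (h ^+ #|V|)%R; set b1 := (h ^+ #|simplices K 1|)%R.
set b2 := (h ^+ #|simplices K 2|)%R; set b3 := (h ^+ #|simplices K 3|)%R.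
set t := (h ^+ #|predC (triples P)|)%R; set e := (h ^+ #|predC (pairs P)|)%R.
set N := (#|ordflat|%:R)%R; set Z := hcard d act P.
have [aa aa1 aa2 cc] : [/\ a != 0, a1 != 0, a2 != 0 & c != 0]%R by split; apply: gn.
have [bb bb1 bb2 bb3] : [/\ b != 0, b1 != 0, b2 != 0 & b3 != 0]%R by split; apply: hn.
have [tt ee] : (t != 0 /\ e != 0)%R by split; apply: hn.
move=> E.
(* This factor is the one in [hcard_total]: all gauge transformations times the arbitrary values of
   a colouring off the complex. *)
have X : (a * (e * (b * (b1 * b1))) * (c * t) != 0)%R by rewrite !mulf_neq0.
apply: (mulIf X); rewrite E; field.
by rewrite aa aa1 aa2 bb1 bb2 bb3.
Qed.

End StateSum.

(** * Barycentric coordinates *)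

Section Coordinates.
Local Open Scope ring_scope.
Variable R : realType.

Definition bary (V : finType) (P : pred (seq V)) (x : V -> R) : Prop :=
  [/\ forall v, 0 <= x v, \sum_v x v = 1 & P (enum [set v | x v != 0]%SET)].

Section OneType.
Variable V : finType.
Notation NE := {S : {set V} | S != finset.set0}.
Implicit Types (x : V -> R) (y : NE -> R) (S T : {set V}).

(** The least value on [S] minus the largest outside. For coordinates in [[0, 1]] its positive part
    is the length of the set of levels [t >= 0] at which [x > t] holds exactly on [S]. The default
    [x v] compares with 0 and covers an empty complement; the default 1 is an upper bound for the
    coordinates. *)
Definition gap x S : R :=
  \big[Order.min/1]_(v in S) \big[Order.min/x v]_(w in ~: S) (x v - x w).
Definition gapp x S : R := Order.max 0 (gap x S).

Lemma gap_le x S v : v \in S -> gap x S <= x v.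
Proof.
move=> vS; apply: le_trans (bigmin_le_cond _ _ vS) _.
exact: bigmin_le_id.
Qed.
Lemma gap_le_sub x S v w : v \in S -> w \notin S -> gap x S <= x v - x w.
Proof.
move=> vS wS; apply: le_trans (bigmin_le_cond _ _ vS) _.
by apply: bigmin_le_cond; rewrite inE.
Qed.
Lemma gap_le1 x S : gap x S <= 1.
Proof. exact: bigmin_le_id. Qed.
Lemma le_gap x S t : t <= 1 -> (forall v, v \in S -> t <= x v) ->
  (forall v w, v \in S -> w \notin S -> t <= x v - x w) -> t <= gap x S.
Proof.
move=> t1 h1 h2; apply: le_bigmin => // v vS; apply: le_bigmin; first exact: h1.
by move=> w; rewrite inE; apply: h2.
Qed.

(* Adding a constant on a set [T] containing the support, and exceeding it, only changes the
   coordinate at [T]; this drives both inductions below. *)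
Lemma gapp_layer (a : R) x x' T S v0 : 0 <= a -> (forall v, 0 <= x' v) ->
  (forall v, x v <= 1) -> (forall v, x v = a * (v \in T)%:R + x' v) ->
  (forall v, v \notin T -> x' v = 0) -> v0 \in T -> x' v0 = 0 -> S != finset.set0 ->
  gapp x S = a * (S == T)%:R + gapp x' S.
Proof.
move=> a0 x'0 x1 xE x'T v0T x'v0 S0.
have x'x v : x' v <= x v by rewrite xE lerDr mulr_ge0.
have [->|ST] := eqVneq S T.
  have -> : gapp x' T = 0.
    by apply/max_idPl; apply: le_trans (gap_le _ v0T) _; rewrite x'v0.
  rewrite mulr1 addr0 /gapp (_ : gap x T = a); first exact/max_idPr.
  apply/eqP; rewrite eq_le; apply/andP; split.
    by apply: le_trans (gap_le _ v0T) _; rewrite xE v0T mulr1 x'v0 addr0.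
  apply: le_gap => [|v vT|v w vT wT].
  - by have := x1 v0; rewrite xE v0T mulr1 x'v0 addr0.
  - by rewrite xE vT mulr1 lerDl.
  by rewrite !xE vT (negPf wT) (x'T w) // mulr1 mulr0 addr0 subr0 lerDl.
rewrite mulr0 add0r /gapp.
have [sub|/fintype.subsetPn[v vS vT]] := boolP (S \subset T); last first.
  have xv : x v = 0 by rewrite xE (negPf vT) x'T // mulr0 addr0.
  have -> : Order.max 0 (gap x' S) = 0.
    by apply/max_idPl; apply: le_trans (gap_le _ vS) _; rewrite x'T.
  by apply/max_idPl; apply: le_trans (gap_le _ vS) _; rewrite xv.
have [w0 w0T w0S] : exists2 w, w \in T & w \notin S.
  by apply/fintype.subsetPn; apply: contra ST => h; rewrite finset.eqEsubset sub.
have inT v : v \in S -> v \in T by move/(fintype.subsetP sub).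
congr Order.max; apply/eqP; rewrite eq_le; apply/andP; split; apply: le_gap => [|v vS|v w vS wS].
- exact: gap_le1.
- apply: le_trans (gap_le_sub _ vS w0S) _.
  by rewrite !xE inT // w0T !mulr1; have := x'0 w0; lra.
- have [wT|wT] := boolP (w \in T).
    by apply: le_trans (gap_le_sub _ vS wS) _; rewrite !xE inT // wT !mulr1; lra.
  apply: le_trans (gap_le_sub _ vS w0S) _; rewrite (x'T _ wT).
  by rewrite !xE inT // w0T !mulr1; have := x'0 w0; lra.
- exact: gap_le1.
- exact: le_trans (gap_le _ vS) _.
have [wT|wT] := boolP (w \in T).
  by apply: le_trans (gap_le_sub _ vS wS) _; rewrite !xE inT // wT !mulr1; lra.
rewrite (xE w) (negPf wT) (x'T _ wT) mulr0 addr0 subr0.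
exact: le_trans (gap_le _ vS) _.
Qed.

(** Inverse to [bar], the affine map sending the vertex [S] of the subdivision to the barycentre of
    [S]; the factor is the inverse of the weight of each vertex in that barycentre. *)
Definition sdc x (S : NE) : R := #|val S|%:R * gapp x (val S).
Definition bar (y : NE -> R) (v : V) : R := \sum_(S : NE | v \in val S) y S / #|val S|%:R.

Lemma ne_card_gt0 (S : NE) : (0 < #|val S|)%N.
Proof. by rewrite finset.card_gt0; case: S. Qed.
Lemma ne_card_neq0 (S : NE) : #|val S|%:R != 0 :> R.
Proof. by rewrite pnatr_eq0 -lt0n ne_card_gt0. Qed.

Lemma gapp_ge0 x S : 0 <= gapp x S.
Proof. by rewrite /gapp le_max lexx. Qed.
Lemma gapp_gt0 x S : gapp x S != 0 -> 0 < gap x S.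
Proof.
move=> h; have : 0 < gapp x S by rewrite lt_def h gapp_ge0.
by rewrite /gapp lt_max ltxx.
Qed.

(** The levels from 0 to [x v] are partitioned by their superlevel sets. The induction peels off the
    bottom layer, supported on [T], which removes the minimal vertex [v0] from the support. *)
Lemma sum_gapp x : (forall v, 0 <= x v <= 1) ->
  forall v, \sum_(S : NE | v \in val S) gapp x (val S) = x v.
Proof.
have [n] := ubnP #|[set v | x v != 0]%SET|; elim: n x => // n IH x lt x01 v.
have [e|/finset.set0Pn[u]] := eqVneq [set v | x v != 0]%SET finset.set0.
  have x0 w : x w = 0.
    by apply/eqP; have := finset.in_set0 w; rewrite -e inE => /negbFE.
  rewrite big1 => [|S vS]; first by rewrite x0.
  by rewrite /gapp (max_idPl _) //; apply: le_trans (gap_le _ vS) _; rewrite x0.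
set T := [set v | x v != 0]%SET => uT.
have [v0 v0T mn] : exists2 v0, v0 \in T & forall v, v \in T -> x v0 <= x v.
  by case: (Order.TotalTheory.arg_minP x uT) => v0 h1 h2; exists v0.
pose x' w := x w - x v0 * (w \in T)%:R.
have x0T w : w \notin T -> x w = 0 by rewrite inE negbK => /eqP.
have x'T w : w \notin T -> x' w = 0 by move=> h; rewrite /x' (negPf h) mulr0 subr0 x0T.
have x'v0 : x' v0 = 0 by rewrite /x' v0T mulr1 subrr.
have x'0 w : 0 <= x' w.
  have [wT|/x'T->//] := boolP (w \in T); by rewrite /x' wT mulr1 subr_ge0 mn.
have a0 : 0 <= x v0 by case/andP: (x01 v0).
have xE w : x w = x v0 * (w \in T)%:R + x' w by rewrite /x' addrC subrK.
have x1 w : x w <= 1 by case/andP: (x01 w).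
rewrite (eq_bigr (fun S : NE => x v0 * (val S == T)%:R + gapp x' (val S))); last first.
  by move=> S _; apply: (@gapp_layer _ x x' T _ v0) => //; case: S.
rewrite big_split /= IH; first last.
- by move=> w; rewrite x'0 /=; apply: le_trans (x1 w); rewrite (xE w) lerDr mulr_ge0.
- apply: leq_trans (_ : #|T| <= n)%N; last by rewrite -ltnS.
  apply: proper_card; rewrite fintype.properE; apply/andP; split.
    by apply/fintype.subsetP => w; rewrite inE; apply: contraNT => /x'T ->.
  by apply/fintype.subsetPn; exists v0; rewrite // inE x'v0 eqxx.
rewrite [RHS]xE; congr (_ + _); rewrite -mulr_sumr; congr (_ * _).
have T0 : T != finset.set0 by apply/finset.set0Pn; exists u.
pose TT : NE := exist _ T T0.
have [vT|vT] := boolP (v \in T).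
  rewrite (bigD1 TT) //= eqxx big1 ?addr0 // => S /andP[_ ne].
  by rewrite (_ : (val S == T) = false) //; apply: contra_neqF ne => /eqP h; apply: val_inj.
rewrite big1 // => S vS; rewrite (_ : (val S == T) = false) //.
by apply: contraNF vT => /eqP <-.
Qed.

Lemma bar_sdc x : (forall v, 0 <= x v <= 1) -> forall v, bar (sdc x) v = x v.
Proof.
move=> x01 v; rewrite -[RHS](sum_gapp x01); apply: eq_bigr => S _.
by rewrite /sdc mulrAC mulfV ?mul1r ?ne_card_neq0.
Qed.

Lemma sum_bar y : \sum_v bar y v = \sum_(S : NE) y S.
Proof.
rewrite /bar (exchange_big_dep predT) //=; apply: eq_bigr => S _.
rewrite sumr_const -[LHS]mulr_natr mulfVK ?ne_card_neq0 //.
Qed.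

Lemma bar_ge0 y v : (forall S : NE, 0 <= y S) -> 0 <= bar y v.
Proof. by move=> y0; apply: sumr_ge0 => S _; rewrite divr_ge0. Qed.

(** Induction on the length of the chain carrying [y], removing its largest face [T]. A vertex [v0]
    of [T] in no smaller face of the chain witnesses that [T] contributes a full layer. *)
Lemma sdc_bar y : (forall S : NE, 0 <= y S) -> \sum_(S : NE) y S <= 1 ->
  (forall S S' : NE, y S != 0 -> y S' != 0 -> comparable_sets S S') ->
  forall S : NE, sdc (bar y) S = y S.
Proof.
have [n] := ubnP #|[set S : NE | y S != 0]%SET|; elim: n y => // n IH y lt y0 y1 ch S.
have [e|/finset.set0Pn[U]] := eqVneq [set S : NE | y S != 0]%SET finset.set0.
  have z (w : NE) : y w = 0.
    by apply/eqP; have := finset.in_set0 w; rewrite -e inE => /negbFE.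
  have bz v : bar y v = 0 by rewrite /bar big1 // => A _; rewrite z mul0r.
  rewrite z /sdc /gapp (max_idPl _) ?mulr0 //.
  by apply: le_trans (gap_le _ (ne_eltP S)) _; rewrite bz.
rewrite inE => yU.
have [T yT mx] : exists2 T : NE, y T != 0 & forall S : NE, y S != 0 -> val S \subset val T.
  case: (arg_maxnP (P := fun S : NE => y S != 0) (fun S : NE => #|val S|) yU) => T yT mx.
  exists T => // A yA; have /orP[//|TA] := ch _ _ yA yT.
  by have /eqP -> : val T == val A by rewrite finset.eqEcard TA; apply: mx.
pose y' (A : NE) := if A == T then 0 else y A.
have y'0 (A : NE) : 0 <= y' A by rewrite /y'; case: ifP.
have [v0 v0T v0n] : exists2 v, v \in val T & forall A : NE, y' A != 0 -> v \notin val A.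
  have [e|/finset.set0Pn[B]] := eqVneq [set A : NE | y' A != 0]%SET finset.set0.
    exists (ne_elt T); first exact: ne_eltP.
    by move=> A yA; have := finset.in_set0 A; rewrite -e inE yA.
  rewrite inE => yB.
  case: (arg_maxnP (P := fun S : NE => y' S != 0) (fun S : NE => #|val S|) yB) => C yC mxC.
  have y'y (A : NE) : y' A != 0 -> A != T /\ y A != 0.
    by rewrite /y'; case: (eqVneq A T) => [_|//]; rewrite eqxx.
  have [CT yC'] := y'y _ yC.
  have [v vT vC] : exists2 v, v \in val T & v \notin val C.
    apply/fintype.subsetPn; apply: contra CT => h; apply/eqP/val_inj/eqP.
    by rewrite finset.eqEsubset mx.
  exists v => // A yA; apply: contra vC; have [_ yA'] := y'y _ yA.
  have /orP[sAC|sCA] := ch _ _ yA' yC'; first exact: (fintype.subsetP sAC).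
  by have /eqP -> : val C == val A by rewrite finset.eqEcard sCA; apply: mxC.
have bE v : bar y v = y T / #|val T|%:R * (v \in val T)%:R + bar y' v.
  rewrite /bar; have [vT|vT] := boolP (v \in val T).
    rewrite (bigD1 T) //= mulr1 [in RHS](bigD1 T) //= /y' eqxx mul0r add0r; congr (_ + _).
    by apply: eq_bigr => A /andP[_ /negPf ->].
  rewrite mulr0 add0r; apply: eq_bigr => A vA; rewrite /y' ifF //.
  by apply: contraNF vT => /eqP <-.
have yE (A : NE) : y A = y T * (A == T)%:R + y' A.
  by rewrite /y'; case: eqVneq => [->|_]; rewrite ?mulr1 ?addr0 ?mulr0 ?add0r.
have by1 v : bar y v <= 1.
  apply: le_trans y1; rewrite /bar big_mkcond; apply: ler_sum => A _; case: ifP => // _.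
  by rewrite ler_pdivrMr ?ltr0n ?ne_card_gt0 // ler_peMr // ler1n ne_card_gt0.
rewrite yE /sdc (@gapp_layer (y T / #|val T|%:R) (bar y) (bar y') (val T) _ v0) //.
- rewrite mulrDr; congr (_ + _).
    rewrite val_eqE; case: eqVneq => [->|_]; last by rewrite !mulr0.
    by rewrite !mulr1 mulrC mulfVK // ne_card_neq0.
  rewrite -[LHS]/(sdc (bar y') S); apply: IH => //.
  + rewrite -ltnS; apply: leq_trans lt; rewrite ltnS.
    apply: proper_card; rewrite fintype.properE; apply/andP; split.
      by apply/fintype.subsetP => A; rewrite !inE /y'; case: ifP => //; rewrite eqxx.
    by apply/fintype.subsetPn; exists T; rewrite ?inE // /y' !eqxx.
  + apply: le_trans y1; apply: ler_sum => A _; rewrite (yE A) lerDr mulr_ge0 //.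
  move=> A A'; rewrite /y'; do 2![case: ifP; rewrite ?eqxx // => _].
  exact: ch.
- by rewrite divr_ge0.
- by move=> v; apply: bar_ge0.
- move=> v vT; rewrite /bar big1 // => A vA; rewrite /y'; case: ifP => [_|/negbT AT].
    by rewrite mul0r.
  have [->|/mx sA] := eqVneq (y A) 0; first by rewrite mul0r.
  by move: vT; rewrite (fintype.subsetP sA).
- rewrite /bar big1 // => A vA; have [->|/v0n] := eqVneq (y' A) 0; first by rewrite mul0r.
  by rewrite vA.
by case: S.
Qed.

Lemma bary01 P x : bary P x -> forall v, 0 <= x v <= 1.
Proof.
move=> [x0 <- _] v; rewrite x0 /= (bigD1 v) //= lerDl.
exact: sumr_ge0.
Qed.

Lemma sdc_star x (S : NE) : sdc x S != 0 -> forall v, v \in val S -> x v != 0.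
Proof.
rewrite mulf_eq0 negb_or => /andP[_ /gapp_gt0 g0] v vS.
by have := lt_le_trans g0 (gap_le x vS); rewrite lt_def => /andP[].
Qed.

Lemma bary_sdc P x : mono P -> bary P x -> bary (sd P) (sdc x).
Proof.
move=> mP bx; have x01 := bary01 bx; case: bx => x0 x1 Px; split.
- by move=> S; rewrite mulr_ge0 ?gapp_ge0.
- by rewrite -sum_bar -[RHS]x1; apply: eq_bigr => v _; rewrite bar_sdc.
apply/andP; split.
  apply/allP => S; rewrite mem_enum inE => nS; apply: mP Px => v.
  by rewrite !mem_enum inE; apply: sdc_star.
apply/allrelP => S S'; rewrite !mem_enum !inE => nS nS'.
(* Incomparable sets of positive weight would force both [x w < x v] and [x v < x w]. *)
apply: contraT; rewrite negb_or => /andP[/fintype.subsetPn[v vS vS'] /fintype.subsetPn[w wS' wS]].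
move: nS nS'; rewrite /sdc !mulf_eq0 !negb_or => /andP[_ /gapp_gt0 a] /andP[_ /gapp_gt0 b].
have := lt_le_trans a (gap_le_sub x vS wS); have := lt_le_trans b (gap_le_sub x wS' vS').
by lra.
Qed.

Lemma sd_max P (s : seq NE) : sd P s -> s != [::] ->
  exists2 M : NE, M \in s & forall S : NE, S \in s -> val S \subset val M.
Proof.
case: s => // S0 s /andP[_ /allrelP ch] _; have i0 : S0 \in S0 :: s by rewrite inE eqxx.
case: (arg_maxnP (P := fun S : NE => S \in S0 :: s) (fun S : NE => #|val S|) i0) => M iM mx.
exists M => // A iA; have /orP[//|MA] := ch _ _ iA iM.
by have /eqP -> : val M == val A by rewrite finset.eqEcard MA; apply: mx.
Qed.

Lemma sd_min P (s : seq NE) : sd P s -> s != [::] ->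
  exists2 M : NE, M \in s & forall S : NE, S \in s -> val M \subset val S.
Proof.
case: s => // S0 s /andP[_ /allrelP ch] _; have i0 : S0 \in S0 :: s by rewrite inE eqxx.
case: (arg_minnP (P := fun S : NE => S \in S0 :: s) (fun S : NE => #|val S|) i0) => M iM mn.
exists M => // A iA; have /orP[|//] := ch _ _ iA iM.
by move=> AM; have /eqP -> : val A == val M by rewrite finset.eqEcard AM; apply: mn.
Qed.

Lemma bar_neq0 y v : bar y v != 0 -> exists2 S : NE, y S != 0 & v \in val S.
Proof.
move=> h; apply: contrapT => n; case/eqP: h; rewrite /bar big1 // => S vS.
have [->|nz] := eqVneq (y S) 0; first by rewrite mul0r.
by case: n; exists S.
Qed.

Lemma bary_bar P y : mono P -> bary (sd P) y -> bary P (bar y).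
Proof.
move=> mP [y0 y1 sy]; split.
- by move=> v; apply: bar_ge0.
- by rewrite sum_bar.
have ne : enum [set S : NE | y S != 0]%SET != [::].
  apply/negP => /eqP e; have : 1 != 0 :> R by apply: oner_neq0.
  rewrite -y1 big1 ?eqxx // => S _; apply/eqP; apply: contraT => nz.
  have : S \in enum [set S : NE | y S != 0]%SET by rewrite mem_enum inE.
  by rewrite e.
have [M iM mx] := sd_max sy ne.
have /andP[/allP /(_ _ iM) PM _] := sy; apply: mP PM => v; rewrite !mem_enum inE.
move/bar_neq0 => [S nz vS]; apply: (fintype.subsetP (mx S _)) vS.
by rewrite mem_enum inE.
Qed.

(** A vertex [v0] of the smallest face lies in every face of the chain, so each barycentre has mass
    at least [1/N] at [v0]. This common mass cancels in a difference of two points, leaving mass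
    [1 - 1/N]. *)
Lemma bar_contract P (s : seq NE) (N : nat) (y y' : NE -> R) : sd P s -> s != [::] ->
  (forall S : NE, S \in s -> #|val S| <= N)%N ->
  (forall S : NE, y S != 0 -> S \in s) -> (forall S : NE, y' S != 0 -> S \in s) ->
  \sum_(S : NE) y S = 1 -> \sum_S y' S = 1 ->
  \sum_v `|bar y v - bar y' v| <= (1 - N%:R^-1) * \sum_(S : NE) `|y S - y' S|.
Proof.
move=> sd_s s0 cN ys ys' y1 y1'; have [M iM mn] := sd_min sd_s s0.
pose v0 := ne_elt M; pose z (S : NE) := y S - y' S.
have v0S (S : NE) : S \in s -> v0 \in val S by move=> /mn/fintype.subsetP; apply; apply: ne_eltP.
have zs (S : NE) : S \notin s -> z S = 0.
  move=> nS; have yS : y S = 0.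
    by apply/eqP; apply: contraT => /ys h; rewrite h in nS.
  have yS' : y' S = 0.
    by apply/eqP; apply: contraT => /ys' h; rewrite h in nS.
  by rewrite /z yS yS' subrr.
have z0 : \sum_(S : NE) z S = 0 by rewrite /z sumrB y1 y1' subrr.
(* Subtracting [1/N] at [v0] from each barycentre is allowed because the coefficients [z] sum to
   0. *)
pose c (S : NE) v := (v \in val S)%:R / #|val S|%:R - (v == v0)%:R / N%:R : R.
have bE v : bar y v - bar y' v = \sum_(S : NE) z S * c S v.
  rewrite /c; under eq_bigr do rewrite mulrBr.
  rewrite sumrB -mulr_suml z0 mul0r subr0 /bar -sumrB big_mkcond /=.
  apply: eq_bigr => S _; case: (v \in val S); rewrite ?mul0r ?mulr0 //.
  by rewrite mul1r /z mulrBl.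
have N0 : (0 < N)%N by apply: leq_trans (cN _ iM); apply: ne_card_gt0.
have c0 (S : NE) v : S \in s -> 0 <= c S v.
  move=> iS; rewrite /c; case: eqVneq => [->|_]; last by rewrite mul0r subr0 divr_ge0.
  rewrite v0S // !mul1r subr_ge0 lef_pV2 ?posrE ?ltr0n ?ne_card_gt0 //.
  by rewrite ler_nat cN.
have cs (S : NE) : \sum_v c S v = 1 - N%:R^-1.
  rewrite /c sumrB; congr (_ - _).
    rewrite -mulr_suml (eq_bigr (fun v => if v \in val S then 1 else 0)); last first.
      by move=> v _; case: (v \in val S).
    by rewrite -big_mkcond sumr_const mulfV // ne_card_neq0.
  rewrite (bigD1 v0) //= eqxx mul1r big1 ?addr0 // => v /negPf ->.
  by rewrite mul0r.
rewrite (le_trans (y := \sum_v \sum_(S : NE) `|z S * c S v|)) //.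
  by apply: ler_sum => v _; rewrite bE; apply: ler_norm_sum.
rewrite exchange_big mulr_sumr; apply: ler_sum => S _.
have [iS|nS] := boolP (S \in s); last first.
  rewrite big1 => [|v _]; rewrite -/(z S) zs // ?mul0r normr0 // mulr0.
under eq_bigr do rewrite normrM (ger0_norm (c0 _ _ iS)).
by rewrite -mulr_sumr cs mulrC.
Qed.

(** The members of a chain have distinct cardinalities between 1 and [N]. Thus the same [N], and the
    same contraction factor, serves all iterated subdivisions. *)
Lemma sd_size (P : pred (seq V)) N (s : seq NE) : (forall S : seq V, P S -> uniq S -> size S <= N)%N ->
  sd P s -> uniq s -> (size s <= N)%N.
Proof.
move=> PN /andP[/allP a /allrelP ch] us.
have inj : {in s &, injective (fun S : NE => #|val S|)}.
  move=> S S' iS iS' e; apply: val_inj; apply/eqP; have /orP[h|h] := ch _ _ iS iS'.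
    by rewrite finset.eqEcard h e leqnn.
  by rewrite eq_sym finset.eqEcard h e leqnn.
rewrite -(size_map (fun S : NE => #|val S|)) -(size_iota 1 N).
apply: uniq_leq_size; first by rewrite map_inj_in_uniq.
move=> _ /mapP[S iS ->]; rewrite mem_iota ne_card_gt0 add1n ltnS cardE.
by apply: PN; [apply: a|apply: enum_uniq].
Qed.

End OneType.
End Coordinates.

(** * Subdivisions of a triangulated space *)

Section Topology.
Local Open Scope ring_scope.
Local Open Scope classical_set_scope.
Variable R : realType.

Lemma continuous_bigmin (M : topologicalType) (I : Type) (r : seq I) (Q : pred I)
    (f0 : M -> R) (F : I -> M -> R) :
  continuous f0 -> (forall i, continuous (F i)) ->
  continuous (fun p => \big[Order.min/f0 p]_(i <- r | Q i) F i p).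
Proof.
move=> c0 cF; elim: r => [|i r IH].
  rewrite (_ : (fun _ => _) = f0) //; apply/funext => p; by rewrite big_nil.
case Qi : (Q i); last first.
  rewrite (_ : (fun _ => _) = (fun p => \big[Order.min/f0 p]_(i <- r | Q i) F i p)) //.
  by apply/funext => p; rewrite big_cons Qi.
rewrite (_ : (fun _ => _) = (F i \min (fun p => \big[Order.min/f0 p]_(i <- r | Q i) F i p))).
  by move=> p; apply: continuous_min; [apply: cF|apply: IH].
by apply/funext => p; rewrite big_cons Qi.
Qed.

Lemma continuous_sumf (M : topologicalType) (I : Type) (r : seq I) (F : I -> M -> R) :
  (forall i, continuous (F i)) -> continuous (fun p => \sum_(i <- r) F i p).
Proof.
move=> cF; elim: r => [|i r IH].
  rewrite (_ : (fun _ => _) = fun=> 0); first exact: cst_continuous.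
  by apply/funext => p; rewrite big_nil.
rewrite (_ : (fun _ => _) = (fun p => F i p + \sum_(i <- r) F i p)).
  by move=> p; apply: continuousD; [apply: cF|apply: IH].
by apply/funext => p; rewrite big_cons.
Qed.

(** Stands in for uniform continuity without a metric on the space: if it fails, the sets where
    [h < e] and [c <= k] generate a filter, and at a cluster point [h] vanishes while [k] does not
    drop below [c]. *)
Lemma compact_uniform (X : topologicalType) (h k : X -> R) (c : R) :
  compact [set: X] -> continuous h -> continuous k -> (forall x, 0 <= h x) ->
  (forall x, h x = 0 -> k x < c) -> exists2 e, 0 < e & forall x, h x < e -> k x < c.
Proof.
move=> cX ch ck h0 hk; apply: contrapT => n.
pose A (e : R) := [set x | h x < e /\ c <= k x].
have An e : 0 < e -> A e !=set0.
  move=> e0; apply: contrapT => ne; apply: n; exists e => // x hx.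
  by rewrite ltNge; apply/negP => kx; apply: ne; exists x.
pose F := filter_from [set e : R | 0 < e] A.
have FF : ProperFilter F.
  apply: filter_from_proper => //; apply: filter_from_filter; first by exists 1 => /=.
  move=> e e' /= e0 e0'; exists (Order.min e e'); first by rewrite /= lt_min e0.
  by move=> x [hx kx]; move: hx; rewrite lt_min => /andP[].
have [|z [_ cl]] := cX F FF; first by exists 1 => //=.
have FA e : 0 < e -> F (A e) by move=> e0; exists e.
have hz : h z = 0.
  apply/eqP; apply: contraT => hn; have hp : 0 < h z by rewrite lt_def hn h0.
  have hp2 : 0 < h z / 2 by rewrite divr_gt0.
  have nb : nbhs z [set x | h z / 2 < h x].
    by apply: (cvgr_gt (h z) (ch z)); rewrite ltr_pdivrMr // ltr_pMr // ltr1n.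
  have [x [[hx _] hx']] := cl _ _ (FA _ hp2) nb.
  by have := lt_trans hx hx'; rewrite ltxx.
have nb : nbhs z [set x | k x < c] by apply: (cvgr_lt (k z) (ck z)); apply: hk.
have [x [[_ kx] kx']] := cl _ _ (FA _ (@ltr01 R)) nb.
by have := le_lt_trans kx kx'; rewrite ltxx.
Qed.

Lemma expr_lt_eps (x e : R) : 0 <= x -> x < 1 -> 0 < e -> exists n, x ^+ n < e.
Proof.
move=> x0 x1 e0; have h : `|x| < 1 by rewrite ger0_norm.
have /filter_ex[n] : \forall n \near \oo, x ^+ n < e by apply: (cvgr_lt 0 (cvg_expr h)).
by exists n.
Qed.

Section Coord.
Variable M : topologicalType.

Definition coord (V : finType) (P : pred (seq V)) (g : M -> V -> R) :=
  [/\ forall v, continuous (fun p => g p v), forall p, bary P (g p)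
    & forall x, bary P x -> exists p, g p = x].

(** The open star of [u] lies inside the open star of [f u]: the condition for [f] to be a
    simplicial approximation of the identity of [M]. *)
Definition starmap (V W : finType) (g : M -> V -> R) (k : M -> W -> R) (f : V -> W) :=
  forall p u, g p u != 0 -> k p (f u) != 0.

Lemma bary_uniform (V : finType) (P : pred (seq V)) (s : seq V) : mono P ->
  P s -> s != [::] -> exists2 x : V -> R, bary P x & forall v, (x v != 0) = (v \in s).
Proof.
move=> mP Ps s0; pose c : R := #|[set v in s]%SET|%:R.
have c0 : c != 0.
  rewrite pnatr_eq0 -lt0n finset.card_gt0; apply/finset.set0Pn.
  by case: s s0 {Ps c} => // a s _; exists a; rewrite !inE eqxx.
have nz v : ((v \in s)%:R / c != 0) = (v \in s).
  by case: (v \in s); rewrite ?mul0r ?eqxx // mul1r invr_eq0 c0.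
exists (fun v => (v \in s)%:R / c) => //; split.
- by move=> v; rewrite divr_ge0 ?ler0n.
- rewrite -mulr_suml (eq_bigr (fun v => if v \in [set v in s]%SET then 1 else 0)).
    by rewrite -big_mkcond sumr_const mulfV.
  by move=> v _; rewrite inE; case: (v \in s).
by apply: mP Ps => v; rewrite mem_enum inE nz.
Qed.

Section Star.
Variables (V W : finType) (P : pred (seq V)) (Q : pred (seq W)).
Variables (g : M -> V -> R) (k : M -> W -> R).
Hypotheses (mP : mono P) (mQ : mono Q) (Q0 : Q [::]).
Hypotheses (cg : coord P g) (ck : coord Q k).

(** A point in the interior of the simplex [s] lies in a simplex of [Q] whose vertices include both
    images of [s]. *)
Lemma starmaps_contiguous (f f' : V -> W) : starmap g k f -> starmap g k f' ->
  forall s, P s -> Q (map f s ++ map f' s).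
Proof.
move=> sf sf' [|a s] Ps //.
have [x bx xE] := bary_uniform mP Ps isT.
have [_ _ /(_ _ bx)[p gp]] := cg; have [_ /(_ p)[_ _ Qp] _] := ck.
apply: mQ Qp => w; rewrite mem_cat => /orP[] /mapP[v vs ->]; rewrite mem_enum inE.
  by apply: sf; rewrite gp xE.
by apply: sf'; rewrite gp xE.
Qed.

Lemma starmap_simplicial (f : V -> W) : starmap g k f -> simplicial f P Q.
Proof.
move=> sf s Ps; have := starmaps_contiguous sf sf Ps.
by apply: mQ => w; rewrite mem_cat orbb.
Qed.

(** At the point [q] of the vertex [u] some coordinate is at least [1/(#|W|+1)], as these sum to 1.
    Points of the star of [u] share a simplex with [q], so that coordinate stays positive on the
    whole star. *)
Lemma fine_starmap (w0 : W) :
  (forall p q s, P s -> (forall u, g p u != 0 -> u \in s) ->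
    (forall u, g q u != 0 -> u \in s) ->
    forall w, `|k p w - k q w| < (#|W|.+1)%:R^-1) ->
  exists f : V -> W, starmap g k f.
Proof.
move=> fine; have [_ bg sg] := cg; have [_ bk _] := ck.
have /choice[f hf] (u : V) : exists w, forall p, g p u != 0 -> k p w != 0.
  have [Pu|nPu] := boolP (P [:: u]); last first.
    (* If [u] is not a vertex its star is empty, and any value will do. *)
    exists w0 => p gu; case/negP: nPu; have [_ _ h] := bg p; apply: mP h => v.
    by rewrite inE => /eqP ->; rewrite mem_enum inE.
  have [x bx xE] := bary_uniform mP Pu isT.
  have [q gq] := sg _ bx; have [k0 k1 _] := bk q.
  have [w wk] : exists w, (#|W|.+1)%:R^-1 <= k q w.
    apply: contrapT => n; have : 1 < 1 :> R; last by rewrite ltxx.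
    rewrite -{1}k1; apply: (@le_lt_trans _ _ (\sum_(w : W) (#|W|.+1)%:R^-1)).
      by apply: ler_sum => w _; apply: ltW; rewrite ltNge; apply/negP => h; apply: n; exists w.
    by rewrite sumr_const -[_ *+ _]mulr_natl ltr_pdivrMr ?ltr0n // mul1r ltr_nat.
  exists w => p gu.
  have := fine q p (enum [set v | g p v != 0]%SET) _ _ _ w; have [_ _ ->] := bg p.
  move=> /(_ isT) h; suff : 0 < k p w by rewrite lt_def => /andP[].
  have lt : `|k q w - k p w| < (#|W|.+1)%:R^-1.
    apply: h => v; last by rewrite mem_enum inE.
    by rewrite gq xE inE => /eqP ->; rewrite mem_enum inE.
  have := le_lt_trans (ler_norm _) lt; move: wk; move: (_ ^-1) => c ? ?; lra.
by exists f => p u; apply: hf.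
Qed.
End Star.

Lemma coord_sd (V : finType) (P : pred (seq V)) (g : M -> V -> R) : mono P ->
  coord P g -> coord (sd P) (fun p => sdc (g p)).
Proof.
move=> mP [cg bg sg]; split.
- move=> S p.
  apply: (@continuousM _ _ (fun=> #|val S|%:R) (fun p => gapp (g p) (val S))).
    exact: cst_continuous.
  apply: (@continuous_max _ _ (fun=> 0) (fun p => gap (g p) (val S))).
    exact: cst_continuous.
  apply: continuous_bigmin; first exact: cst_continuous.
  move=> v; apply: continuous_bigmin; first exact: cg.
  by move=> w q; apply: continuousB; apply: cg.
- by move=> p; apply: bary_sdc.
move=> y bY; have [p gp] := sg _ (bary_bar mP bY); exists p; apply/funext => S.
rewrite gp; case: bY => y0 y1 /andP[_ /allrelP ch]; apply: sdc_bar => //.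
  by rewrite y1.
by move=> A B yA yB; apply: ch; rewrite mem_enum inE.
Qed.

Section Iterate.
Variables (G H : finGroupType) (d : H -> G) (act : G -> H -> H).
Hypothesis cm : crossed_module d act.
Variables (V : finType) (P : pred (seq V)) (g : M -> V -> R) (N : nat).
Hypotheses (mP : mono P) (P0 : P [::]) (cg : coord P g).
Hypothesis PN : forall s, P s -> uniq s -> (size s <= N)%N.

(** The distance is measured in the original coordinates [g], so each subdivision contributes one
    factor of [bar_contract]. *)
Lemma iterated_sd n : exists (V' : finType) (P' : pred (seq V')) (g' : M -> V' -> R)
    (f : V' -> V),
  [/\ mono P', P' [::], coord P' g' & forall s, P' s -> uniq s -> (size s <= N)%N] /\
  [/\ forall p q s, P' s -> (forall u, g' p u != 0 -> u \in s) ->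
        (forall u, g' q u != 0 -> u \in s) ->
        \sum_v `|g p v - g q v| <= (1 - N%:R^-1) ^+ n * \sum_u `|g' p u - g' q u|,
      faithful d act f P' P, starmap g' g f & dominated d act P' P].
Proof.
elim: n => [|n [V' [P' [g' [f [[mP' P0' cg' PN'] [ct F sf dm]]]]]]].
  exists V, P, g, id; split; split=> //.
  - by move=> p q s _ _ _; rewrite expr0 mul1r.
  - exact: faithful_id.
  by exists id.
exists {S : {set V'} | S != finset.set0}, (sd P'), (fun p => sdc (g' p)), (f \o (@ne_elt V')).
have cs := coord_sd mP' cg'; have [_ bg' _] := cg'.
have star1 : starmap (fun p => sdc (g' p)) g' (@ne_elt V').
  by move=> p S nz; apply: (sdc_star nz); apply: ne_eltP.
have sf' : simplicial f P' P by apply: (starmap_simplicial mP' mP P0 cg' cg).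
split; split=> //.
- exact: mono_sd.
- by move=> s; apply: sd_size.
- move=> p q s Ps sp sq.
  have s0 : s != [::].
    apply/negP => /eqP e; have [_ /(_ p)[_ y1 _] _] := cs.
    have : 1 != 0 :> R by apply: oner_neq0.
    rewrite -y1 big1 ?eqxx // => S _; apply/eqP; apply: contraT => /sp.
    by rewrite e.
  have [X iX mx] := sd_max Ps s0; have /andP[/allP al _] := Ps.
  have sup r u : (forall S, sdc (g' r) S != 0 -> S \in s) -> g' r u != 0 -> u \in enum (val X).
    move=> sr; rewrite -(bar_sdc (bary01 (bg' r))) => /bar_neq0[S /sr iS uS].
    by rewrite mem_enum; apply: (fintype.subsetP (mx _ iS)).
  apply: le_trans (ct p q _ (al _ iX) _ _) _.
  + by move=> u; apply: sup.
  + by move=> u; apply: sup.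
  have N1 : 0 <= 1 - N%:R^-1 :> R.
    rewrite subr_ge0 invf_le1 ?ler1n ?ltr0n.
      by apply: leq_trans (PN' _ (al _ iX) (enum_uniq _)); rewrite -cardE ne_card_gt0.
    by apply: leq_trans (PN' _ (al _ iX) (enum_uniq _)); rewrite -cardE ne_card_gt0.
  rewrite exprSr -mulrA ler_wpM2l ?exprn_ge0 //.
  have [_ yp1 _] := bary_sdc mP' (bg' p); have [_ yq1 _] := bary_sdc mP' (bg' q).
  have := bar_contract Ps s0 (N := N) _ sp sq yp1 yq1.
  rewrite (eq_bigr (fun v => `|g' p v - g' q v|)); last first.
    by move=> v _; rewrite !bar_sdc //; apply: bary01 (bg' _).
  apply=> S iS; rewrite cardE; apply: PN'; first exact: al.
  exact: enum_uniq.
- by apply: faithful_comp sf' _ F; apply: ne_elt_faithful.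
- by move=> p u nz; apply: sf; apply: star1.
apply: dominated_trans dm.
have [F1 E1] := sd_cyl_sd_equiv cm mP' P0'; have [F2 E2] := sd_cyl_base_equiv cm mP'.
(* Colourings extend from the subdivision to the cylinder and restrict from the cylinder to its
   base. *)
apply: (@dominated_trans _ _ _ _ _ _ _ (sd P') (sd_cyl P') P').
  apply: (extending_dominated cm (f := inr)) => //; first exact: mono_sd.
    exact: mono_sd_cyl.
  by move=> s; rewrite sd_cyl_inr.
apply: (faithful_dominated cm (f := inl)) => //; first exact: mono_sd_cyl.
by move=> s; rewrite sd_cyl_inl.
Qed.

End Iterate.

Lemma bary_dist (V : finType) (P : pred (seq V)) (x y : V -> R) :
  bary P x -> bary P y -> \sum_v `|x v - y v| <= 2.
Proof.
move=> [x0 x1 _] [y0 y1 _]; apply: (@le_trans _ _ (\sum_v (x v + y v))).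
  apply: ler_sum => v _; apply: le_trans (ler_normB _ _) _.
  by rewrite !ger0_norm.
by rewrite big_split /= x1 y1.
Qed.

Section Fine.
Variables (G H : finGroupType) (d : H -> G) (act : G -> H -> H).
Hypothesis cm : crossed_module d act.
Hypothesis cM : compact [set: M].

Lemma coord_uniform (V W : finType) (P : pred (seq V)) (g : M -> V -> R) (k : M -> W -> R)
    (c : R) : coord P g -> injective g -> (forall w, continuous (fun p => k p w)) -> 0 < c ->
  exists2 e, 0 < e & forall p q, \sum_v `|g p v - g q v| < e ->
    forall w, `|k p w - k q w| < c.
Proof.
move=> [cg _ _] gi ck c0.
have cd (U : finType) (f : M -> U -> R) : (forall u, continuous (fun p => f p u)) ->
    continuous (fun z : M * M => \sum_u `|f z.1 u - f z.2 u|).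
  move=> cf; apply: continuous_sumf => u z.
  apply: (@continuous_comp _ _ _ (fun z : M * M => f z.1 u - f z.2 u) Num.norm); last first.
    exact: norm_continuous.
  apply: continuousB.
    apply: (@continuous_comp _ _ _ fst (fun p => f p u)); [exact: cvg_fst|exact: cf].
  apply: (@continuous_comp _ _ _ snd (fun p => f p u)); [exact: cvg_snd|exact: cf].
have cMM : compact [set: M * M] by rewrite -setXTT; apply: compact_setX.
have [|z h|e e0 he] := compact_uniform (c := c) cMM (cd _ g cg) (cd _ k ck).
- by move=> z; apply: sumr_ge0.
- have e : z.1 = z.2.
    apply: gi; apply/funext => v; apply/eqP; rewrite -subr_eq0 -normr_eq0.
    move/eqP: h; rewrite psumr_eq0 // => /allP /(_ v).
    by rewrite mem_index_enum => /(_ isT).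
  by rewrite e big1 // => w _; rewrite subrr normr0.
exists e => // p q lt w; apply: le_lt_trans (he (p, q) lt).
by rewrite /= (bigD1 w) //= lerDl sumr_ge0.
Qed.

Lemma fine_subdivision (V W : finType) (P : pred (seq V)) (g : M -> V -> R)
    (k : M -> W -> R) (c : R) : mono P -> P [::] -> coord P g -> injective g ->
  (forall w, continuous (fun p => k p w)) -> 0 < c ->
  exists (V' : finType) (P' : pred (seq V')) (g' : M -> V' -> R) (f : V' -> V),
  [/\ mono P', P' [::] & coord P' g'] /\
  [/\ faithful d act f P' P, starmap g' g f, dominated d act P' P &
    forall p q s, P' s -> (forall u, g' p u != 0 -> u \in s) ->
    (forall u, g' q u != 0 -> u \in s) -> forall w, `|k p w - k q w| < c].
Proof.
move=> mP P0 cg gi ck c0; have [e e0 he] := coord_uniform cg gi ck c0.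
(* The successor keeps [N] positive even when [V] is empty. *)
pose N := #|V|.+1.
have PN s : P s -> uniq s -> (size s <= N)%N.
  by move=> _ /card_uniqP <-; apply: leq_trans (max_card _) _.
have N0 : 0 < N%:R^-1 :> R by rewrite invr_gt0 ltr0n.
have N1 : N%:R^-1 <= 1 :> R by rewrite invf_le1 ?ler1n ?ltr0n.
(* The bound is [e / 2] because barycentric points are at distance at most 2. *)
have [|||n hn] := @expr_lt_eps (1 - N%:R^-1) (e / 2).
- by rewrite subr_ge0.
- by rewrite ltrBlDr ltrDl.
- by rewrite divr_gt0.
have [V' [P' [g' [f [[mP' P0' cg' _] [ct F sf dm]]]]]] := iterated_sd cm mP P0 cg PN n.
exists V', P', g', f; split; split=> // p q s Ps sp sq; apply: he.
apply: le_lt_trans (ct p q s Ps sp sq) _.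
have [_ bg' _] := cg'; have d2 := bary_dist (bg' p) (bg' q).
apply: le_lt_trans (ler_wpM2l _ d2) _; first by rewrite exprn_ge0 // subr_ge0.
by rewrite -ltr_pdivlMr.
Qed.

(** Both [phi \o psi] and the subdivision map [l] approximate the identity of [M], hence are
    contiguous. Faithfulness passes from [l] to the composite and then to [phi], so [Q] is dominated
    by the subdivision [P'], which is dominated by [P]. *)
Lemma coord_dominated (V W : finType) (P : pred (seq V)) (Q : pred (seq W))
    (g : M -> V -> R) (k : M -> W -> R) :
  mono P -> P [::] -> coord P g -> injective g -> (forall v, P [:: v]) ->
  mono Q -> Q [::] -> coord Q k -> injective k -> (forall w, Q [:: w]) ->
  dominated d act Q P.
Proof.
move=> mP P0 cg gi P1 mQ Q0 ck ki Q1.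
(* If [M] is empty there are no vertices on either side, and the empty map is faithful. *)
have [[p0 _]|nM] := pselect (exists p : M, True); last first.
  have nV (v : V) : False.
    have [x bx _] := bary_uniform mP (P1 v) isT; have [_ _ /(_ _ bx)[p _]] := cg.
    by apply: nM; exists p.
  have nW (w : W) : False.
    have [x bx _] := bary_uniform mQ (Q1 w) isT; have [_ _ /(_ _ bx)[p _]] := ck.
    by apply: nM; exists p.
  apply: (@faithful_dominated _ _ _ _ cm V W (fun v => match nV v with end)) => //.
    by case=> [|v s] // _; case: (nV v).
  split=> [x y _ _ _|x s r _ _ _|x r _ _ _ w]; last by case: (nW w).
    by exists (gone G H W); split=> w; case: (nW w).
  by exists (fun=> 1%g); split=> w; case: (nW w).
have inh (U : finType) (A : pred (seq U)) (f : M -> U -> R) : coord A f -> exists u : U, True.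
  move=> [_ /(_ p0)[_ f1 _] _]; apply: contrapT => n.
  have : 1 != 0 :> R by apply: oner_neq0.
  by rewrite -f1 big1 ?eqxx // => u; case: n; exists u.
have [w0 _] := inh _ _ _ ck.
have cinv (U : finType) : 0 < (#|U|.+1)%:R^-1 :> R by rewrite invr_gt0 ltr0n.
have [ck1 _ _] := ck.
have [V' [P' [g' [f [[mP' P0' cg'] [F sf dm fine]]]]]] :=
  fine_subdivision mP P0 cg gi ck1 (cinv W).
have [phi sphi] := fine_starmap mP' cg' ck w0 fine.
have [u0 _] := inh _ _ _ cg'; have [cg1 _ _] := cg'.
(* [Q] is subdivided only now, finely enough for the coordinates of the subdivision [P'] already
   fixed. *)
have [W' [Q' [k' [l [[mQ' Q0' ck'] [Fl sl _ fine']]]]]] :=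
  fine_subdivision mQ Q0 ck ki cg1 (cinv V').
have [psi spsi] := fine_starmap mQ' ck' cg' u0 fine'.
have scomp : starmap k' k (phi \o psi) by move=> p u nz; apply: sphi; apply: spsi.
have Fc : faithful d act (phi \o psi) Q' Q.
  apply: (contiguous_faithful cm mQ' _ mQ Fl).
  exact: (starmaps_contiguous mQ' mQ Q0 ck' ck sl scomp).
have Fphi : faithful d act phi P' Q.
  by apply: faithful_left Fc; apply: (starmap_simplicial mQ' mP' P0' ck' cg').
apply: dominated_trans dm; apply: (faithful_dominated cm mP' mQ _ Fphi).
exact: (starmap_simplicial mP' mQ Q0 cg' ck).
Qed.

Lemma triangulation_coord (V : finType) (K : {set {set V}}) :
  triangulation R K M -> exists2 g : M -> V -> R, coord (cplx K) g & injective g.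
Proof.
move=> [f [g [_ [cg [gf fg]]]]].
have rb x : realization K x <-> bary (cplx K) x.
  have e : [set v in enum [set v | x v != 0]%SET]%SET = [set v | x v != 0]%SET.
    by apply/setP => v; rewrite inE mem_enum.
  split=> [[x0 [x1 xK]]|[x0 x1 xK]].
    by split=> //; rewrite /cplx e xK orbT.
  split=> //; split=> //; move: xK; rewrite /cplx e => /orP[/eqP en|//].
  move/eqP: x1; rewrite big1 => [|v _]; first by rewrite eq_sym oner_eq0.
  apply/eqP; apply: contraT => nz.
  have : v \in enum [set v | x v != 0]%SET by rewrite mem_enum inE.
  by rewrite en.
exists g; last by move=> p q e; have [_ <-] := fg p; have [_ <-] := fg q; rewrite e.
split.
- move=> v p; apply: (@continuous_comp _ _ _ g (fun x : {ptws V -> R} => x v)); first exact: cg.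
  exact: (@proj_continuous V (fun=> R) v).
- by move=> p; apply/rb; have [] := fg p.
by move=> x /rb rx; exists (f x); apply: gf.
Qed.

End Fine.
End Coord.
End Topology.

Theorem theorem4p1
  (G H : finGroupType) (d : H -> G) (act : G -> H -> H)
  (cm : crossed_module d act)
  (R : realType) (M : topologicalType)
  (hM : hausdorff_space M) (cM : compact [set: M])
  (mM : manifold3_with_boundary R M)
  (V1 : finType) (K1 : {set {set V1}}) (rank1 : V1 -> nat)
  (sc1 : simplicial_complex K1) (inj1 : injective rank1)
  (tr1 : triangulation R K1 M)
  (V2 : finType) (K2 : {set {set V2}}) (rank2 : V2 -> nat)
  (sc2 : simplicial_complex K2) (inj2 : injective rank2)
  (tr2 : triangulation R K2 M) :
  Zinv d act K1 rank1 = Zinv d act K2 rank2.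
Proof.
rewrite !Zinv_hcard //.
have [g1 c1 i1] := triangulation_coord tr1; have [g2 c2 i2] := triangulation_coord tr2.
have m1 := mono_cplx sc1; have m2 := mono_cplx sc2.
have s1 := cplx1 sc1; have s2 := cplx1 sc2.
apply: dominated_hcard => //.
  exact: (coord_dominated cm cM m2 isT c2 i2 s2 m1 isT c1 i1 s1).
exact: (coord_dominated cm cM m1 isT c1 i1 s1 m2 isT c2 i2 s2).
Qed.
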